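(* Let $k$ be a field of characteristic $0$, let $\underline{\lambda}$ be a pure tuple of partitions, and let $V_{\underline{\lambda}}$ be the universal homogeneous countable $\underline{\lambda}$-space over $k$. Then $V_{\underline{\lambda}}$ has vector-quantifier elimination: every formula of $\mathcal{L}_{\underline{\lambda}}$ is equivalent modulo the theory of $V_{\underline{\lambda}}$ to a formula containing no quantifiers over vector variables.
   Context: Schur functor $\mathbf{S}_\lambda(V)=\operatorname{Hom}_{\mathfrak{S}_n}(S^\lambda,V^{\otimes n})$ for $\lambda\vdash n$; a $\lambda$-form is a linear map $\mathbf{S}_\lambda(V)\to k$; a $\underline{\lambda}$-space for $\underline{\lambda}=[\lambda_1,\ldots,\lambda_r]$ (pure: all $\lambda_i$ non-empty) is a $k$-vector space with a $\lambda_i$-form $\omega_i$ for each $i$; embeddings are injective linear maps pulling back the forms. $V_{\underline{\lambda}}$ is the (unique up to isomorphism) $\underline{\lambda}$-space of countably infinite dimension that is universal (every finite-dimensional $\underline{\lambda}$-space embeds) and homogeneous (every isomorphism between finite-dimensional subspaces extends to an automorphism). The language $\mathcal{L}_{\underline{\lambda}}$ is two-sorted (scalars, vectors), with scalar $+,\cdot$, a constant for each element of $k$, scalar-vector multiplication, vector addition, a constant $\mathbf{0}$, and for each $i$ a scalar-valued function symbol $\omega_i$ of $|\lambda_i|$ vector arguments, interpreted on $k\amalg V$ via the multilinear map $V^{|\lambda_i|}\to k$ encoding the $\lambda_i$-form (the $n$-form that agrees with $\omega_i$ on the isotypic summand $S^{\lambda_i}\otimes\mathbf{S}_{\lambda_i}(V)$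 of $V^{\otimes n}$ in the direction of a fixed standard tableau and vanishes on all other standard-tableau components). The theory of $V$ is the set of $\mathcal{L}_{\underline{\lambda}}$-sentences true in $k\amalg V$; two formulas are equivalent modulo it if the sentence asserting their equivalence for all values of the free variables belongs to it. *)

(* Defs.v *)
From HB Require Import structures.
From mathcomp Require Import all_boot all_order all_fingroup all_algebra.
From mathcomp Require Import boolp functions.

Set Implicit Arguments.
Unset Strict Implicit.
Unset Printing Implicit Defensive.

Import generic_quotient GRing.Theory.
Local Open Scope ring_scope.
Local Open Scope quotient_scope.

Section TensorPower.
Variables (k : fieldType) (n : nat) (V : lmodType k).

Definition upd (v : {ffun 'I_n -> V}) (i : 'I_n) (x : V) : {ffun 'I_n -> V} :=
  [ffun j => if j == i then x else v j].

Definition multilinear (W : lmodType k) (m : {ffun 'I_n -> V} -> W) : Prop :=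
  forall i v, linear (fun x => m (upd v i x)).

(* Formal linear combinations of pure tensors. Two of them represent the same
   tensor iff every multilinear map into every vector space identifies them;
   this is the quotient of the free module by the multilinearity relations,
   with the universal property used as the definition of the congruence. *)
Definition tsum : Type := seq (k * {ffun 'I_n -> V}).

HB.instance Definition _ := Choice.on tsum.

Definition teval (W : lmodType k) (m : {ffun 'I_n -> V} -> W) (s : tsum) : W :=
  \sum_(p <- s) p.1 *: m p.2.

Definition tsum_eq (s t : tsum) : bool :=
  `[< forall (W : lmodType k) (m : {ffun 'I_n -> V} -> W),
        multilinear m -> teval m s = teval m t >].

Fact tsum_eq_refl : reflexive tsum_eq.
Proof. by move=> s; apply/asboolP. Qed.

Fact tsum_eq_sym : symmetric tsum_eq.
Proof.
by move=> s t; apply/asboolP/asboolP => h W m hm; rewrite (h W m hm).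
Qed.

Fact tsum_eq_trans : transitive tsum_eq.
Proof.
move=> t s u /asboolP h1 /asboolP h2; apply/asboolP => W m hm.
by rewrite (h1 W m hm) (h2 W m hm).
Qed.

Canonical tsum_equiv :=
  EquivRel tsum_eq tsum_eq_refl tsum_eq_sym tsum_eq_trans.

Definition tpow : Type := {eq_quot tsum_equiv}.

HB.instance Definition _ := EqQuotient.on tpow.
HB.instance Definition _ := Choice.on tpow.

(* The linear map tpow -> W induced by m; meaningful for m multilinear. *)
Definition tlift (W : lmodType k) (m : {ffun 'I_n -> V} -> W) (x : tpow) : W :=
  teval m (repr x).

Lemma tliftE (W : lmodType k) (m : {ffun 'I_n -> V} -> W) (s : tsum) :
  multilinear m -> tlift m (\pi_tpow s) = teval m s.
Proof.
move=> hm; rewrite /tlift.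
have /eqmodP/asboolP : \pi_tpow (repr (\pi_tpow s)) = \pi_tpow s
  by rewrite reprK.
by apply.
Qed.

Lemma tpow_ext (x y : tpow) :
  (forall (W : lmodType k) (m : {ffun 'I_n -> V} -> W),
     multilinear m -> tlift m x = tlift m y) -> x = y.
Proof.
by move=> h; rewrite -[x]reprK -[y]reprK; apply/eqmodP/asboolP.
Qed.

Definition tens (v : {ffun 'I_n -> V}) : tpow := \pi_tpow [:: (1, v)].

Definition tzero : tpow := \pi_tpow [::].
Definition tadd (x y : tpow) : tpow := \pi_tpow (repr x ++ repr y).
Definition tscale (a : k) (x : tpow) : tpow :=
  \pi_tpow [seq (a * p.1, p.2) | p <- repr x].
Definition topp (x : tpow) : tpow := tscale (- 1) x.

Section Lift.
Variables (W : lmodType k) (m : {ffun 'I_n -> V} -> W).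
Hypothesis hm : multilinear m.

Lemma tlift_tens v : tlift m (tens v) = m v.
Proof. by rewrite tliftE // /teval big_seq1 scale1r. Qed.

Lemma tlift_tzero : tlift m tzero = 0.
Proof. by rewrite tliftE // /teval big_nil. Qed.

Lemma tlift_tadd x y : tlift m (tadd x y) = tlift m x + tlift m y.
Proof. by rewrite tliftE // /teval big_cat. Qed.

Lemma tlift_tscale a x : tlift m (tscale a x) = a *: tlift m x.
Proof.
rewrite tliftE // /teval big_map scaler_sumr.
by apply: eq_bigr => p _; rewrite scalerA.
Qed.

Lemma tlift_topp x : tlift m (topp x) = - tlift m x.
Proof. by rewrite tlift_tscale scaleN1r. Qed.
End Lift.

Fact taddA : associative tadd.
Proof. by move=> x y z; apply: tpow_ext => W m h; rewrite !tlift_tadd // addrA. Qed.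
Fact taddC : commutative tadd.
Proof. by move=> x y; apply: tpow_ext => W m h; rewrite !tlift_tadd // addrC. Qed.
Fact tadd0 : left_id tzero tadd.
Proof.
by move=> x; apply: tpow_ext => W m h; rewrite tlift_tadd // tlift_tzero // add0r.
Qed.
Fact taddN : left_inverse tzero topp tadd.
Proof.
move=> x; apply: tpow_ext => W m h.
by rewrite tlift_tadd // tlift_topp // tlift_tzero // addNr.
Qed.
HB.instance Definition _ := GRing.isZmodule.Build tpow taddA taddC tadd0 taddN.

Fact tscaleA a b x : tscale a (tscale b x) = tscale (a * b) x.
Proof. by apply: tpow_ext => W m h; rewrite !tlift_tscale // scalerA. Qed.
Fact tscale1 : left_id 1 tscale.
Proof. by move=> x; apply: tpow_ext => W m h; rewrite tlift_tscale // scale1r. Qed.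
Fact tscaleDr : right_distributive tscale +%R.
Proof.
move=> a x y; apply: tpow_ext => W m h.
by rewrite !(tlift_tscale, tlift_tadd) // scalerDr.
Qed.
Fact tscaleDl x : {morph tscale^~ x : a b / a + b}.
Proof.
move=> a b; apply: tpow_ext => W m h.
by rewrite !(tlift_tscale, tlift_tadd) // scalerDl.
Qed.
HB.instance Definition _ :=
  GRing.Zmodule_isLmodule.Build k tpow tscaleA tscale1 tscaleDr tscaleDl.

Lemma tlift_linear (W : lmodType k) (m : {ffun 'I_n -> V} -> W) :
  multilinear m -> linear (tlift m).
Proof. by move=> hm a x y; rewrite tlift_tadd // tlift_tscale. Qed.

Lemma tens_multilinear : multilinear tens.
Proof.
move=> i v a x y; apply: tpow_ext => W m hm.
by rewrite tlift_linear // !tlift_tens // (hm i v a x y).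
Qed.

(* The left action of permutations on tensors by permuting places. *)
Definition tact (s : {perm 'I_n}) : tpow -> tpow :=
  tlift (fun v => tens [ffun i => v ((s^-1)%g i)]).

Lemma tact_multilinear (s : {perm 'I_n}) :
  multilinear (fun v : {ffun 'I_n -> V} => tens [ffun i => v ((s^-1)%g i)]).
Proof.
move=> i v a x y.
have E z : [ffun j => upd v i z ((s^-1)%g j)]
    = upd [ffun j => v ((s^-1)%g j)] (s i) z.
  by apply/ffunP => j; rewrite !ffunE -(inj_eq (@perm_inj _ s)) permKV.
by rewrite !E; exact: tens_multilinear.
Qed.

Fact tact_linear s : linear (tact s).
Proof. exact: tlift_linear (tact_multilinear s). Qed.
HB.instance Definition _ s :=
  GRing.isLinear.Build k tpow tpow _ (tact s) (tact_linear s).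

End TensorPower.

Section TensorMap.
Variables (k : fieldType) (n : nat) (V W : lmodType k) (h : {linear V -> W}).

Definition tmap : tpow n V -> tpow n W :=
  tlift (fun v : {ffun 'I_n -> V} => tens [ffun i => h (v i)]).

Lemma tmap_multilinear :
  multilinear (fun v : {ffun 'I_n -> V} => tens [ffun i => h (v i)]).
Proof.
move=> i v a x y.
have E z : [ffun j => h (upd v i z j)] = upd [ffun j => h (v j)] i (h z).
  by apply/ffunP => j; rewrite !ffunE; case: ifP.
by rewrite !E linearP; exact: tens_multilinear.
Qed.

Fact tmap_linear : linear tmap.
Proof. exact: tlift_linear tmap_multilinear. Qed.
HB.instance Definition _ :=
  GRing.isLinear.Build k (tpow n V) (tpow n W) _ tmap tmap_linear.

Lemma tpow_span (x : tpow n V) : x = \sum_(p <- repr x) p.1 *: tens p.2.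
Proof.
apply: tpow_ext => U m hm; pose f := HB.pack_for {linear tpow n V -> U} (tlift m)
  (GRing.isLinear.Build k _ _ _ (tlift m) (tlift_linear hm)).
rewrite -[tlift m (\sum_(p <- _) _)]/(f _) linear_sum.
by apply: eq_bigr => p _; rewrite linearZ /= tlift_tens.
Qed.

Lemma tmap_tact (s : {perm 'I_n}) x : tmap (tact s x) = tact s (tmap x).
Proof.
rewrite (tpow_span x).
rewrite (linear_sum (tact s)) !(linear_sum tmap) (linear_sum (tact s)).
apply: eq_bigr => p _.
rewrite (linearZ_LR (tact s)) !(linearZ_LR tmap).
rewrite (linearZ_LR (tact s)) /= /tact /tmap.
rewrite (tlift_tens (tact_multilinear s)) !(tlift_tens tmap_multilinear).
rewrite (tlift_tens (tact_multilinear s)); congr (_ *: tens _).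
by apply/ffunP => i; rewrite !ffunE.
Qed.
End TensorMap.

Record int_partition (n : nat) := IntPartition {
  parts :> seq nat;
  partsP : [&& sorted geq parts, 0%N \notin parts & sumn parts == n] }.

Section Specht.
Variable n : nat.

(* A tableau with entries 'I_n is encoded by the map sending each entry to the
   (row, column) of its cell. A partition of n has at most n rows and columns,
   so both coordinates can be taken in 'I_n; since the diagram has n cells,
   injectivity makes every cell occupied exactly once. *)
Definition tableau : Type := {ffun 'I_n -> 'I_n * 'I_n}.
HB.instance Definition _ := Finite.on tableau.

Definition is_tableau (mu : int_partition n) (T : tableau) : bool :=
  injectiveb T && [forall a, (T a).2 < nth 0 mu (T a).1]%N.

Definition is_standard (mu : int_partition n) (T : tableau) : bool :=
  is_tableau mu T &&
  [forall a, forall b,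
     (((T a).1 == (T b).1) && ((T a).2 < (T b).2)%N ==> (a < b)%N) &&
     (((T a).2 == (T b).2) && ((T a).1 < (T b).1)%N ==> (a < b)%N)].

(* A tabloid is encoded by the map sending each entry to its row. The direct
   sum of the permutation modules on all row maps is used as the ambient
   space, so that it does not depend on the shape. *)
Definition tabloid : Type := {ffun 'I_n -> 'I_n}.
HB.instance Definition _ := Finite.on tabloid.

Definition tabloid_of (T : tableau) : tabloid := [ffun a => (T a).1].

Definition tabloid_act (s : {perm 'I_n}) (t : tabloid) : tabloid :=
  [ffun a => t ((s^-1)%g a)].

Definition tableau_act (s : {perm 'I_n}) (T : tableau) : tableau :=
  [ffun a => T ((s^-1)%g a)].

Definition col_stab (T : tableau) : {set {perm 'I_n}} :=
  [set s : {perm 'I_n} | [forall a, (T (s a)).2 == (T a).2]].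

Variable k : fieldType.

Definition tabmod : Type := {ffun tabloid -> k^o}.
HB.instance Definition _ := Vector.on tabmod.

Definition tabvec (t : tabloid) : tabmod := [ffun u => (u == t)%:R].

Definition tabmod_act (s : {perm 'I_n}) (x : tabmod) : tabmod :=
  [ffun u => x (tabloid_act (s^-1)%g u)].

Fact tabmod_act_linear s : linear (tabmod_act s).
Proof. by move=> a x y; apply/ffunP => u; rewrite !ffunE. Qed.
HB.instance Definition _ s :=
  GRing.isLinear.Build k tabmod tabmod _ (tabmod_act s) (tabmod_act_linear s).

Definition polytabloid (T : tableau) : tabmod :=
  \sum_(s in col_stab T) (-1) ^+ s *: tabvec (tabloid_act s (tabloid_of T)).

Definition specht (mu : int_partition n) : {vspace tabmod} :=
  <<[seq polytabloid T | T <- enum (is_tableau mu)]>>%VS.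

Lemma mem_specht mu T : is_tableau mu T -> polytabloid T \in specht mu.
Proof. by move=> hT; apply/memv_span/map_f; rewrite mem_enum. Qed.

Lemma tabmod_act_tabvec s t : tabmod_act s (tabvec t) = tabvec (tabloid_act s t).
Proof.
apply/ffunP => u; rewrite !ffunE; congr ((_ : bool)%:R).
apply/eqP/eqP => [<-|->]; apply/ffunP => a; rewrite !ffunE.
  by rewrite invgK permKV.
by rewrite invgK permK.
Qed.

Lemma tabmod_act_polytabloid s T :
  tabmod_act s (polytabloid T) = polytabloid (tableau_act s T).
Proof.
rewrite /polytabloid linear_sum [RHS](reindex_inj (conjg_inj s)) /=.
apply: eq_big => [c|c _].
  rewrite !inE; apply/forallP/forallP => h a.
    by rewrite !ffunE /conjg !permM permK.
  by have := h (s a); rewrite !ffunE /conjg !permM !permK.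
rewrite linearZ /= odd_permJ tabmod_act_tabvec; congr (_ *: tabvec _).
by apply/ffunP => a; rewrite !ffunE /conjg !invMg invgK !permM permK.
Qed.

Lemma is_tableau_act mu s T : is_tableau mu T -> is_tableau mu (tableau_act s T).
Proof.
case/andP => /injectiveP inj /forallP h; apply/andP; split.
  by apply/injectiveP => a b; rewrite !ffunE => /inj /perm_inj.
by apply/forallP => a; rewrite !ffunE.
Qed.

Lemma specht_stable mu s x : x \in specht mu -> tabmod_act s x \in specht mu.
Proof.
move=> hx; rewrite (coord_span hx) linear_sum rpred_sum // => i _.
rewrite linearZ rpredZ //=.
have : (i < size [seq polytabloid T | T <- enum (is_tableau mu)])%N
  by rewrite size_map -cardE ltn_ord.
move=> /(mem_nth 0) /mapP [T hT ->].
rewrite tabmod_act_polytabloid; apply/mem_specht/is_tableau_act.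
by rewrite mem_enum in hT.
Qed.

Definition specht_act mu (s : {perm 'I_n}) (x : subvs_of (specht mu)) :
    subvs_of (specht mu) :=
  vsproj (specht mu) (tabmod_act s (vsval x)).

Lemma specht_actE mu s (x : subvs_of (specht mu)) :
  vsval (specht_act s x) = tabmod_act s (vsval x).
Proof. by rewrite vsprojK // specht_stable // subvsP. Qed.

Definition specht_polytabloid mu (T : tableau) : subvs_of (specht mu) :=
  vsproj (specht mu) (polytabloid T).

Lemma specht_polytabloidE mu T :
  is_tableau mu T -> vsval (specht_polytabloid mu T) = polytabloid T.
Proof. by move=> hT; rewrite vsprojK // mem_specht. Qed.

End Specht.

Section Schur.
Variables (k : fieldType) (n : nat) (mu : int_partition n) (V : lmodType k).

(* Hom_{S_n}(S^mu, V^{(x) n}), as a subspace of the space of all functions. *)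
Definition schur_pred : {pred (subvs_of (specht k mu) -> tpow n V)} :=
  fun f => `[< linear f /\ forall s x, f (specht_act s x) = tact s (f x) >].

Fact schur_closed : submod_closed schur_pred.
Proof.
split.
  apply/asboolP; split=> [a x y|s x]; first by rewrite /= scaler0 addr0.
  by rewrite [RHS](linear0 (tact s)).
move=> a f g /asboolP [fl fe] /asboolP [gl ge]; apply/asboolP; split.
  move=> b x y; rewrite !addrfctE !scalrfctE fl gl !scalerDr !scalerA.
  by rewrite [a * b]mulrC addrACA.
move=> s x; rewrite !addrfctE !scalrfctE fe ge.
by rewrite (linearD (tact s)) (linearZ_LR (tact s)).
Qed.
HB.instance Definition _ :=
  GRing.isSubmodClosed.Build k (subvs_of (specht k mu) -> tpow n V) schur_pred
    schur_closed.

Record schur : Type := Schur {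
  schur_fun :> subvs_of (specht k mu) -> tpow n V;
  schurP : schur_fun \in schur_pred }.

HB.instance Definition _ := [isSub for schur_fun].
HB.instance Definition _ := [Choice of schur by <:].
HB.instance Definition _ := [SubChoice_isSubLmodule of schur by <:].

End Schur.
Arguments schur_pred {k n} mu V.

Section SchurMap.
Variables (k : fieldType) (n : nat) (mu : int_partition n) (V W : lmodType k).
Variable h : {linear V -> W}.

Fact schur_map_subproof (f : schur mu V) :
  (fun x => tmap h (f x)) \in schur_pred mu W.
Proof.
case: f => f /= /asboolP [fl fe]; apply/asboolP; split.
  by move=> a x y; rewrite fl (linearP (tmap h)).
by move=> s x; rewrite fe tmap_tact.
Qed.

Definition schur_map (f : schur mu V) : schur mu W :=
  Schur (schur_map_subproof f).

Fact schur_map_linear : linear schur_map.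
Proof.
move=> a f g; apply/val_inj/funext => x.
rewrite linearP /= !addrfctE !scalrfctE /=.
by rewrite -(linearP (tmap h)).
Qed.
HB.instance Definition _ :=
  GRing.isLinear.Build k (schur mu V) (schur mu W) _ schur_map schur_map_linear.
End SchurMap.

Section Spaces.
Variables (k : fieldType) (r : nat) (d : 'I_r -> nat).
Variable lam : forall i : 'I_r, int_partition (d i).

(* A lam-space is a vector space V together with an element of [forms V]. *)
Definition forms (V : lmodType k) : Type :=
  forall i : 'I_r, {linear schur (lam i) V -> k^o}.

Definition pullback (V W : lmodType k) (h : {linear V -> W}) (w : forms W) :
    forms V :=
  fun i => w i \o schur_map h.

Definition embedding (V W : lmodType k) (v : forms V) (w : forms W)
    (h : {linear V -> W}) : Prop :=
  injective h /\ forall i, pullback h w i =1 v i.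

Definition isomorphism (V W : lmodType k) (v : forms V) (w : forms W)
    (h : {linear V -> W}) : Prop :=
  embedding v w h /\ bijective h.
End Spaces.

Section Subspace.
Variables (k : fieldType) (V : lmodType k) (U : submodClosed V).

Record subspace : Type := Subspace {
  subspace_val : V;
  subspaceP : subspace_val \in U }.

HB.instance Definition _ := [isSub for subspace_val].
HB.instance Definition _ := [Choice of subspace by <:].
HB.instance Definition _ := [SubChoice_isSubLmodule of subspace by <:].

Definition incl : {linear subspace -> V} := \val.
End Subspace.

Definition finite_dim (k : fieldType) (V : lmodType k) : Prop :=
  exists (n : nat) (b : 'I_n -> V),
    forall v, exists c : 'I_n -> k, v = \sum_(i < n) c i *: b i.

Definition countably_infinite_dim (k : fieldType) (V : lmodType k) : Prop :=
  exists b : nat -> V,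
    (forall v, exists (n : nat) (c : 'I_n -> k), v = \sum_(i < n) c i *: b i) /\
    (forall (n : nat) (c : 'I_n -> k),
       \sum_(i < n) c i *: b i = 0 -> forall i, c i = 0).

Section UniversalHomogeneous.
Variables (k : fieldType) (r : nat) (d : 'I_r -> nat).
Variables (lam : forall i : 'I_r, int_partition (d i)) (V : lmodType k).
Variable w : forms lam V.

Definition universal : Prop :=
  forall (E : vectType k) (e : forms lam E),
    exists h : {linear E -> V}, embedding e w h.

Definition homogeneous : Prop :=
  forall (U U' : submodClosed V) (h : {linear subspace U -> subspace U'}),
    finite_dim (subspace U) -> finite_dim (subspace U') ->
    isomorphism (pullback (incl U) w) (pullback (incl U') w) h ->
    exists s : {linear V -> V},
      isomorphism w w s /\ forall u, s (incl U u) = incl U' (h u).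
End UniversalHomogeneous.

(* The n-form m encodes the mu-form w in the direction of the standard tableau
   T of shape mu. As the standard polytabloids e_T' of shape nu form a basis of
   S^nu, the tensor power V^{(x) n} is the direct sum, over all nu and all
   standard T' of shape nu, of the components {f e_T' | f in S_nu(V)}; since T'
   determines its shape, "the other components" are those with T' <> T. In
   characteristic 0 there is therefore exactly one such m for each w. *)
Definition encodes (k : fieldType) (n : nat) (mu : int_partition n) (V : lmodType k)
    (T : tableau n) (w : {linear schur mu V -> k^o})
    (m : {ffun 'I_n -> V} -> k^o) : Prop :=
  [/\ multilinear m,
      forall f : schur mu V, tlift m (f (specht_polytabloid k mu T)) = w f
    & forall (nu : int_partition n) (T' : tableau n) (f : schur nu V),
        is_standard nu T' -> T' != T ->
        tlift m (f (specht_polytabloid k nu T')) = 0].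

Section Language.
Variables (k : fieldType) (r : nat) (d : 'I_r -> nat).

(* Scalar and vector variables are named by natural numbers, separately for
   each sort. *)
Inductive sterm : Type :=
| SVar of nat
| SConst of k
| SAdd of sterm & sterm
| SMul of sterm & sterm
| SForm (i : 'I_r) of ('I_(d i) -> vterm)
with vterm : Type :=
| VVar of nat
| VZero
| VAdd of vterm & vterm
| VScale of sterm & vterm.

Inductive formula : Type :=
| FEqS of sterm & sterm
| FEqV of vterm & vterm
| FNot of formula
| FAnd of formula & formula
| FOr of formula & formula
| FImp of formula & formula
| FAllS of nat & formula
| FExS of nat & formula
| FAllV of nat & formula
| FExV of nat & formula.

Definition FIff (p q : formula) : formula := FAnd (FImp p q) (FImp q p).

Fixpoint vector_quantifier_free (p : formula) : bool :=
  match p with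
  | FEqS _ _ | FEqV _ _ => true
  | FNot p => vector_quantifier_free p
  | FAnd p q | FOr p q | FImp p q =>
      vector_quantifier_free p && vector_quantifier_free q
  | FAllS _ p | FExS _ p => vector_quantifier_free p
  | FAllV _ _ | FExV _ _ => false
  end.

Fixpoint sterm_free_svars (t : sterm) : seq nat :=
  match t with
  | SVar x => [:: x]
  | SConst _ => [::]
  | SAdd t u | SMul t u => sterm_free_svars t ++ sterm_free_svars u
  | SForm i a => flatten [seq vterm_free_svars (a j) | j <- enum 'I_(d i)]
  end
with vterm_free_svars (t : vterm) : seq nat :=
  match t with
  | VVar _ | VZero => [::]
  | VAdd t u => vterm_free_svars t ++ vterm_free_svars u
  | VScale a t => sterm_free_svars a ++ vterm_free_svars t
  end.

Fixpoint sterm_free_vvars (t : sterm) : seq nat :=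
  match t with
  | SVar _ | SConst _ => [::]
  | SAdd t u | SMul t u => sterm_free_vvars t ++ sterm_free_vvars u
  | SForm i a => flatten [seq vterm_free_vvars (a j) | j <- enum 'I_(d i)]
  end
with vterm_free_vvars (t : vterm) : seq nat :=
  match t with
  | VVar x => [:: x]
  | VZero => [::]
  | VAdd t u => vterm_free_vvars t ++ vterm_free_vvars u
  | VScale a t => sterm_free_vvars a ++ vterm_free_vvars t
  end.

Fixpoint free_svars (p : formula) : seq nat :=
  match p with
  | FEqS t u => sterm_free_svars t ++ sterm_free_svars u
  | FEqV t u => vterm_free_svars t ++ vterm_free_svars u
  | FNot p => free_svars p
  | FAnd p q | FOr p q | FImp p q => free_svars p ++ free_svars q
  | FAllS x p | FExS x p => [seq y <- free_svars p | y != x]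
  | FAllV _ p | FExV _ p => free_svars p
  end.

Fixpoint free_vvars (p : formula) : seq nat :=
  match p with
  | FEqS t u => sterm_free_vvars t ++ sterm_free_vvars u
  | FEqV t u => vterm_free_vvars t ++ vterm_free_vvars u
  | FNot p => free_vvars p
  | FAnd p q | FOr p q | FImp p q => free_vvars p ++ free_vvars q
  | FAllS _ p | FExS _ p => free_vvars p
  | FAllV x p | FExV x p => [seq y <- free_vvars p | y != x]
  end.

Definition sentence (p : formula) : Prop := free_svars p = [::] /\ free_vvars p = [::].

Definition universal_closure (p : formula) : formula :=
  foldr FAllS (foldr FAllV p (free_vvars p)) (free_svars p).

Section Semantics.
Variables (V : lmodType k) (m : forall i : 'I_r, {ffun 'I_(d i) -> V} -> k^o).

Definition assign (A : Type) (e : nat -> A) (x : nat) (a : A) : nat -> A :=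
  fun y => if y == x then a else e y.

Fixpoint seval (es : nat -> k) (ev : nat -> V) (t : sterm) : k :=
  match t with
  | SVar x => es x
  | SConst c => c
  | SAdd t u => seval es ev t + seval es ev u
  | SMul t u => seval es ev t * seval es ev u
  | SForm i a => m [ffun j : 'I_(d i) => veval es ev (a j)]
  end
with veval (es : nat -> k) (ev : nat -> V) (t : vterm) : V :=
  match t with
  | VVar x => ev x
  | VZero => 0
  | VAdd t u => veval es ev t + veval es ev u
  | VScale a t => seval es ev a *: veval es ev t
  end.

Fixpoint holds (es : nat -> k) (ev : nat -> V) (p : formula) : Prop :=
  match p with
  | FEqS t u => seval es ev t = seval es ev u
  | FEqV t u => veval es ev t = veval es ev u
  | FNot p => ~ holds es ev p
  | FAnd p q => holds es ev p /\ holds es ev q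
  | FOr p q => holds es ev p \/ holds es ev q
  | FImp p q => holds es ev p -> holds es ev q
  | FAllS x p => forall a, holds (assign es x a) ev p
  | FExS x p => exists a, holds (assign es x a) ev p
  | FAllV x p => forall v, holds es (assign ev x v) p
  | FExV x p => exists v, holds es (assign ev x v) p
  end.

Definition in_theory (p : formula) : Prop :=
  sentence p /\ forall es ev, holds es ev p.

Definition equiv_mod_theory (p q : formula) : Prop :=
  in_theory (universal_closure (FIff p q)).

Definition vector_quantifier_elimination : Prop :=
  forall p : formula,
    exists q : formula, vector_quantifier_free q /\ equiv_mod_theory p q.
End Semantics.
End Language.

(* Main.v *)
(* Evaluated on combinations of linearly independent vectors b_1, ..., b_p, a formula
   depends only on the coordinates of its vector variables and on the values of the
   forms at the b_i. A quantified vector either lies in the span of the b_i, and is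
   then given by p scalars, or enlarges the independent family, and is then given by
   the new values of the forms: universality and homogeneity say that these can be
   prescribed arbitrarily inside the finite-dimensional space of arrays that encode
   lambda-forms. So all vector quantifiers become scalar quantifiers, and it remains
   to quantify over the choice of a basis among the free vector variables.

   Passing between lambda-forms and multilinear maps needs the encoding to be unique,
   that is, V^{(x) n} to be spanned by the images of standard polytabloids. Garnir
   relations reduce this to all polytabloids, and it remains to see that no nonzero
   S_n-module is killed by all Young symmetrizers. Choose a column map c, then a row
   map t, of maximal energy (sum of squared fibre sizes) whose antisymmetrizer,
   respectively symmetrizer, does not kill the module. The sum of all transpositions
   acts on the result by a content computed from t and by one computed from c; in
   characteristic 0 these agree, which forces the sets of columns met by the rows to be
   nested, so that (t, c) is a Young tableau up to relabelling. *)

From HB Require Import structures.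
Require Import Defs.
From mathcomp Require Import all_boot all_order all_fingroup all_algebra.
From mathcomp Require Import boolp functions.
From mathcomp Require Import zify.

Set Implicit Arguments.
Unset Strict Implicit.
Unset Printing Implicit Defensive.
Import GRing.Theory.
Local Open Scope ring_scope.

(** * Symmetrizers and contents *)

Lemma mulrn_char0 (k : fieldType) (W : lmodType k) (x : W) (m : nat) :
  [pchar k] =i pred0 -> x *+ m = 0 -> (0 < m)%N -> x = 0.
Proof.
move=> /pcharf0P ch0 /eqP; rewrite -scaler_nat scaler_eq0 ch0 => h m0.
by move: h; rewrite eqn0Ngt m0 => /eqP.
Qed.

Section Energy.
Variable n : nat.
Implicit Types t c : {ffun 'I_n -> 'I_n}.

(** A map [t] assigns the entries to rows, or to columns, with no shape imposed; its stabilizer is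
    the Young subgroup of its fibres. *)
Definition stab t : {set {perm 'I_n}} :=
  [set s : {perm 'I_n} | [forall a, t (s a) == t a]].

Lemma stabP t (s : {perm 'I_n}) : reflect (forall a, t (s a) = t a) (s \in stab t).
Proof. by rewrite inE; apply/(iffP forallP) => h a; apply/eqP. Qed.

Lemma stab1 t : 1%g \in stab t.
Proof. by apply/stabP => a; rewrite perm1. Qed.

Lemma stabMr t (s h : {perm 'I_n}) :
  h \in stab t -> ((s * h)%g \in stab t) = (s \in stab t).
Proof.
move=> /stabP H; apply/stabP/stabP => K a; have := K a; rewrite permM H //.
Qed.

Lemma stab_tperm t a b : t a = t b -> tperm a b \in stab t.
Proof. by move=> E; apply/stabP => x; case: tpermP => [->|->|]. Qed.

Definition fiber_size t i : nat := #|[set a | t a == i]|.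
Definition energy t : nat := (\sum_i fiber_size t i ^ 2)%N.
(** For fibres forming the rows of a diagram, [same_pairs t] minus [min_pairs t] is twice the sum of
    the contents. In general it will be, up to sign, the scalar by which [transpositions] acts on an
    extremal vector. *)
Definition same_pairs t : nat := (\sum_a \sum_(b | b != a) (t b == t a))%N.
Definition min_pairs t : nat :=
  (\sum_i \sum_(j | j != i) minn (fiber_size t i) (fiber_size t j))%N.

Definition move t a i : {ffun 'I_n -> 'I_n} := [ffun b => if b == a then i else t b].

(** Moving an entry from a fibre of size [y + 1] to one of size [x], with [y + 1 <= x], changes the
    sum of squares by [2 (x - y) > 0]. *)
Lemma energy_move t a i :
  t a != i -> (fiber_size t (t a) <= fiber_size t i)%N ->
  (energy t < energy (move t a i))%N.
Proof.
move=> ai le; rewrite /energy (bigD1 i) //= [X in (_ < X)%N](bigD1 i) //=.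
rewrite (bigD1 (t a)) //= [X in (_ < _ + X)%N](bigD1 (t a)) //=.
have Ei : fiber_size (move t a i) i = (fiber_size t i).+1.
  rewrite /fiber_size (cardsD1 a) inE ffunE eqxx eqxx add1n; congr _.+1.
  apply: eq_card => b; rewrite !inE ffunE.
  by case: (eqVneq b a) => [->|//]; rewrite (negbTE ai).
have Ea : fiber_size t (t a) = (fiber_size (move t a i) (t a)).+1.
  rewrite {1}/fiber_size (cardsD1 a) inE eqxx add1n; congr _.+1.
  apply: eq_card => b; rewrite !inE ffunE.
  by case: (eqVneq b a) => [->|//]; rewrite eq_sym (negbTE ai).
have Eo : (\sum_(j | (j != i) && (j != t a)) fiber_size t j ^ 2)%N
    = (\sum_(j | (j != i) && (j != t a)) fiber_size (move t a i) j ^ 2)%N.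
  apply: eq_bigr => j /andP[ji ja]; congr (_ ^ 2)%N; apply: eq_card => b.
  rewrite !inE ffunE; case: (eqVneq b a) => [->|//].
  have -> : (t a == j) = false by rewrite eq_sym (negbTE ja).
  by rewrite eq_sym (negbTE ji).
rewrite Eo Ei !addnA ltn_add2r; move: le; rewrite Ea.
set x := fiber_size t i; set y := fiber_size _ (t a) => le.
by rewrite -!mulnn; nia.
Qed.
Lemma energy_perm t (h : {perm 'I_n}) : energy [ffun a => t (h a)] = energy t.
Proof.
apply: eq_bigr => i _; congr (_ ^ 2)%N; rewrite /fiber_size.
rewrite -[RHS](card_preimset _ (@perm_inj _ h)); apply: eq_card => a.
by rewrite !inE ffunE.
Qed.
End Energy.

Section Symmetrizers.
Variables (k : fieldType) (n : nat) (W : lmodType k).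
Hypothesis char0 : [pchar k] =i pred0.
Variable act : {perm 'I_n} -> {linear W -> W}.
Hypothesis act1 : forall x, act 1%g x = x.
Hypothesis actM : forall s t x, act s (act t x) = act (t * s)%g x.

(** The flag selects the trivial character ([false], for rows) or the sign ([true], for columns), so
    that both cases share their proofs. *)
Definition chi (e : bool) (s : {perm 'I_n}) : k := (-1) ^+ (e && s).

Lemma chiM e s h : chi e (s * h)%g = chi e s * chi e h.
Proof. by rewrite /chi odd_permM; case: e; rewrite ?mulr1 //= signr_addb. Qed.

Lemma chi1 e : chi e 1%g = 1.
Proof. by rewrite /chi odd_perm1 andbF. Qed.

Lemma chi_sqr e s : chi e s * chi e s = 1.
Proof. by rewrite /chi -signr_addb addbb. Qed.

Lemma chi_tperm e a b : a != b -> chi e (tperm a b) = (-1) ^+ e.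
Proof. by move=> ab; rewrite /chi odd_tperm ab andbT. Qed.

Definition symm (e : bool) (t : {ffun 'I_n -> 'I_n}) (x : W) : W :=
  \sum_(s in stab t) chi e s *: act s x.

Fact symm_linear e t : linear (symm e t).
Proof.
move=> a x y; rewrite /symm scaler_sumr -big_split; apply: eq_bigr => s _ /=.
by rewrite linearP scalerDr !scalerA mulrC.
Qed.
HB.instance Definition _ e t :=
  GRing.isLinear.Build k W W _ (symm e t) (symm_linear e t).

Definition semi_invariant e t x := forall s, s \in stab t -> act s x = chi e s *: x.

Lemma symm_semi_invariant e t x : semi_invariant e t (symm e t x).
Proof.
move=> s hs; rewrite linear_sum scaler_sumr /= [RHS](reindex_inj (mulIg s)) /=.
apply: eq_big => [h|h _]; first by rewrite stabMr.
by rewrite linearZ /= actM scalerA chiM mulrCA chi_sqr mulr1.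
Qed.

Lemma symm_act e t s x : s \in stab t -> symm e t (act s x) = chi e s *: symm e t x.
Proof.
move=> hs; rewrite /symm scaler_sumr [RHS](reindex_inj (mulgI s)) /=.
apply: eq_big => [h|h _].
  apply/stabP/stabP => H a; have /stabP hs' := hs.
    by rewrite permM H hs'.
  by have := H ((s^-1)%g a); rewrite permM permKV => ->; rewrite -hs' permKV.
by rewrite actM scalerA chiM mulrA chi_sqr mul1r.
Qed.

Lemma act_symm e t h x :
  act h (symm e t x) = symm e [ffun a => t ((h^-1)%g a)] (act h x).
Proof.
rewrite linear_sum /= /symm [RHS](reindex_inj (conjg_inj h)) /=.
apply: eq_big => [s|s _].
  apply/stabP/stabP => H a; first by rewrite !ffunE /conjg !permM permK H.
  by have := H (h a); rewrite !ffunE /conjg !permM !permK.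
rewrite linearZ /= !actM; congr (_ *: act _ x); last by rewrite conjgE mulKVg.
by rewrite /chi odd_permJ.
Qed.

(* Every element of the stabilizer of [move t a i] is an element of [stab t]
   fixing [a] followed by the transposition of [a] with its image. *)
Lemma exchange_eq0 e t x a i :
  semi_invariant e t x -> t a != i -> symm e (move t a i) x = 0 ->
  x + (-1) ^+ e *: (\sum_(b | t b == i) act (tperm a b) x) = 0.
Proof.
move=> inv ai; set t' := move t a i => h0.
have t'a : t' a = i by rewrite ffunE eqxx.
have t't b : b != a -> t' b = t b by move=> ba; rewrite ffunE (negbTE ba).
pose F b := chi e (tperm a b) *: act (tperm a b) x.
have step s : s \in stab t' -> chi e s *: act s x = F (s a).
  move=> hs; set b := s a; pose h := (s * tperm a b)%g.
  have hE : s = (h * tperm a b)%g by rewrite -mulgA tperm2 mulg1.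
  have t'b : t' a = t' b by rewrite /b; move/stabP: hs => ->.
  have ht' : h \in stab t' by rewrite stabMr // stab_tperm.
  have ha : h a = a by rewrite permM tpermR.
  have ht : h \in stab t.
    apply/stabP => c; case: (eqVneq c a) => [->|ca]; first by rewrite ha.
    have hca : h c != a by rewrite -[X in _ != X]ha (inj_eq perm_inj).
    by rewrite -(t't _ hca) -(t't _ ca); move/stabP: ht' => ->.
  by rewrite /F hE -actM inv // linearZ /= scalerA chiM mulrAC chi_sqr mul1r.
(* Right multiplication by [tperm a b] matches the elements sending [a] to [b] with those fixing
   [a]. Hence every [F b] occurs [N] times, and [N > 0] is cancelled in characteristic 0. *)
pose N := #|[set s in stab t' | s a == a]|.
have fib b : t' b == i ->
    \sum_(s in stab t' | s a == b) F (s a) = F b *+ N.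
  move=> /eqP t'b; rewrite (reindex_inj (mulIg (tperm a b))) /=.
  rewrite (eq_big (fun s => (s \in stab t') && (s a == a)) (fun _ => F b)).
  - by rewrite sumr_const /N; congr (_ *+ _); apply: eq_card => s; rewrite inE.
  - move=> s; rewrite stabMr ?stab_tperm ?t'a ?t'b // permM.
    by rewrite (can2_eq (tpermK a b) (tpermK a b)) tpermR.
  - move=> s /andP[_ /eqP ->] //.
move: h0; rewrite /symm (eq_bigr _ step).
rewrite (partition_big (fun s : {perm 'I_n} => s a) (fun b => t' b == i)) /=; last first.
  by move=> s /stabP ->; rewrite t'a.
rewrite (eq_bigr _ fib) sumrMnl => /(mulrn_char0 char0) h0.
have {}h0 : \sum_(b | t' b == i) F b = 0.
  by apply: h0; apply/card_gt0P; exists 1%g; rewrite inE stab1 perm1 eqxx.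
rewrite -[RHS]h0 [RHS](bigD1 a) /=; last by rewrite t'a.
rewrite [F a]/F tperm1 chi1 act1 scale1r; congr (_ + _).
rewrite scaler_sumr; apply: eq_big => [b|b /eqP tb].
  case: (eqVneq b a) => [->|ba]; first by rewrite (negbTE ai) andbF.
  by rewrite t't // andbT.
by rewrite /F chi_tperm //; apply: contraNneq ai => ->; rewrite tb.
Qed.

(** An analogue of a highest weight vector: moving an entry to another fibre at least as large
    raises the energy, so the resulting symmetrizer kills [x] and [exchange_eq0] applies. *)
Definition extremal e t x :=
  semi_invariant e t x /\
  forall t', (energy t < energy t')%N -> symm e t' x = 0.

(** Ordered pairs count each transposition twice. The operator commutes with the action because
    conjugation permutes the transpositions. *)
Definition transpositions (x : W) : W :=
  \sum_a \sum_(b | b != a) act (tperm a b) x.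

(** By symmetry fibre [i] may be taken to be the smaller one. Each of its entries can be moved into
    fibre [j], and the exchange relation for this move evaluates the inner sum; the outer sum counts
    the entries of fibre [i]. *)
Lemma transpositions_pair e t x i j : extremal e t x -> i != j ->
  \sum_(a | t a == i) \sum_(b | t b == j) act (tperm a b) x
  = - ((-1) ^+ e *: (x *+ minn (fiber_size t i) (fiber_size t j))).
Proof.
move=> [inv ext].
wlog le : i j / (fiber_size t i <= fiber_size t j)%N => [IH|] ij.
  case/orP: (leq_total (fiber_size t i) (fiber_size t j)) => le; first exact: IH.
  rewrite exchange_big minnC -IH // 1?eq_sym //.
  by apply: eq_bigr => a _; apply: eq_bigr => b _; rewrite tpermC.
rewrite (minn_idPl le).
rewrite (eq_bigr (fun _ => - ((-1) ^+ e *: x))) => [|a /eqP ta].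
  rewrite sumr_const mulNrn -scalerMnr /fiber_size; congr (- (_ *+ _)).
  by apply: eq_card => a; rewrite inE.
have := @exchange_eq0 e t x a j inv; rewrite ta => /(_ ij) H.
have /H : symm e (move t a j) x = 0 by apply/ext/energy_move; rewrite ta.
move=> /(congr1 (fun y => (-1) ^+ e *: y)); rewrite scaler0 scalerDr scalerA.
by rewrite -signr_addb addbb scale1r => /eqP; rewrite addrC addr_eq0 => /eqP.
Qed.

(** Pairs inside a fibre act through the character, pairs in two different fibres through
    [transpositions_pair]. *)
Lemma transpositionsE e t x : extremal e t x ->
  transpositions x + (-1) ^+ e *: (x *+ min_pairs t) = (-1) ^+ e *: (x *+ same_pairs t).
Proof.
move=> hx; have [inv _] := hx.
have -> : transpositions x = \sum_a \sum_(b | (b != a) && (t b == t a)) act (tperm a b) x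
   + \sum_a \sum_(b | t b != t a) act (tperm a b) x.
  rewrite -big_split; apply: eq_bigr => a _ /=.
  rewrite (bigID (fun b => t b == t a)) /=; congr (_ + _).
  by apply: eq_bigl => b; case: eqVneq => [->|//]; rewrite eqxx.
have -> : \sum_a \sum_(b | (b != a) && (t b == t a)) act (tperm a b) x
    = (-1) ^+ e *: (x *+ same_pairs t).
  rewrite /same_pairs -sumrMnr scaler_sumr; apply: eq_bigr => a _.
  rewrite -sumrMnr scaler_sumr big_mkcondr; apply: eq_bigr => b ba.
  case: eqP => [tba|_]; last by rewrite scaler0.
  by rewrite mulr1n inv ?stab_tperm // chi_tperm // eq_sym.
have -> : \sum_a \sum_(b | t b != t a) act (tperm a b) x
    = - ((-1) ^+ e *: (x *+ min_pairs t)).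
  rewrite /min_pairs -sumrMnr scaler_sumr -sumrN.
  rewrite (partition_big t xpredT) //=; apply: eq_bigr => i _.
  rewrite -sumrMnr scaler_sumr -sumrN.
  transitivity (\sum_(a | t a == i) \sum_(j | j != i) \sum_(b | t b == j) act (tperm a b) x).
    apply: eq_bigr => a /eqP ta; rewrite (partition_big t (fun j => j != i)) /=; last first.
      by move=> b; rewrite ta.
    apply: eq_bigr => j ji; apply: eq_bigl => b; rewrite ta.
    by case: (eqVneq (t b) j) => [->|]; rewrite ?ji ?andbF.
  rewrite exchange_big; apply: eq_bigr => j ji.
  by rewrite (@transpositions_pair e) // eq_sym.
by rewrite addrNK.
Qed.

Lemma transpositions_act s x : transpositions (act s x) = act s (transpositions x).
Proof.
rewrite linear_sum [LHS](reindex_inj (@perm_inj _ s)); apply: eq_bigr => a _ /=.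
rewrite linear_sum [LHS](reindex_inj (@perm_inj _ s)) /=; apply: eq_big => [b|b _].
  by rewrite (inj_eq perm_inj).
by rewrite !actM -tpermJ conjgE mulKVg.
Qed.

Fact transpositions_linear : linear transpositions.
Proof.
move=> c x y; rewrite /transpositions scaler_sumr -big_split; apply: eq_bigr => a _ /=.
rewrite scaler_sumr -big_split; apply: eq_bigr => b _ /=.
by rewrite linearP.
Qed.
HB.instance Definition _ :=
  GRing.isLinear.Build k W W _ transpositions transpositions_linear.

Lemma transpositions_symm e t x : transpositions (symm e t x) = symm e t (transpositions x).
Proof.
rewrite linear_sum /symm; apply: eq_bigr => s _.
by rewrite linearZ /= transpositions_act.
Qed.

(** Take [t] of maximal energy among the maps whose symmetrizer does not kill every translate of
    [x]. A symmetrizer of larger energy kills all translates, hence also [symm e t (act g x)], which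
    is a combination of them. *)
Lemma exists_extremal e t0 x g0 : symm e t0 (act g0 x) != 0 ->
  exists t g, [/\ symm e t (act g x) != 0 & extremal e t (symm e t (act g x))].
Proof.
move=> nz; pose P (t : {ffun 'I_n -> 'I_n}) := `[< exists g, symm e t (act g x) != 0 >].
have P0 : P t0 by apply/asboolP; exists g0.
case: (@arg_maxnP _ t0 P (@energy n) P0) => t /asboolP[g hg] tmax.
exists t, g; split=> //; split; first exact: symm_semi_invariant.
move=> t' lt; apply/eqP; rewrite {2}/symm linear_sum big1 // => s _ /=.
rewrite linearZ /= actM; case: (eqVneq (symm e t' (act (g * s)%g x)) 0) => [->|h].
  by rewrite scaler0.
have /tmax : P t' by apply/asboolP; exists (g * s)%g.
by rewrite /= leqNgt lt.
Qed.

Lemma extremal_act e t x (h : {perm 'I_n}) :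
  extremal e t x -> extremal e [ffun a => t ((h^-1)%g a)] (act h x).
Proof.
move=> [inv ext]; split=> [s hs|t'].
  have ht : (s ^ h^-1)%g \in stab t.
    apply/stabP => a; move/stabP/(_ (h a)): hs.
    by rewrite !ffunE conjgE invgK !permM permK.
  have := inv _ ht; move/(congr1 (act h)); rewrite actM linearZ /=.
  have -> : (s ^ h^-1 * h = h * s)%g by rewrite conjgE invgK -!mulgA mulVg mulg1.
  by rewrite -actM /chi odd_permJ.
rewrite energy_perm => lt.
have -> : symm e t' (act h x) = act h (symm e [ffun a => t' (h a)] x).
  by rewrite act_symm; congr (symm _ _ _); apply/ffunP => a; rewrite !ffunE permKV.
by rewrite ext ?linear0 // energy_perm.
Qed.

(* The sum of all transpositions acts on [y] by a content computed from [t] and by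
   one computed from [c]; in characteristic 0 they agree. *)
Lemma exists_contents_eq x : x != 0 ->
  exists t c g, [/\ symm false t (symm true c (act g x)) != 0,
     injective (fun a => (t a, c a)) &
     (same_pairs t + same_pairs c = min_pairs t + min_pairs c)%N].
Proof.
(* The fibres of the identity map are singletons, so its symmetrizer is the identity and kills no
   nonzero vector; both searches for an extremal map start there. *)
move=> x0; pose id0 : {ffun 'I_n -> 'I_n} := [ffun a => a].
have stab0 s : (s \in stab id0) = (s == 1%g).
  apply/stabP/eqP => [h|-> a]; last by rewrite perm1.
  by apply/permP => a; have := h a; rewrite !ffunE perm1.
have symm0 e y : symm e id0 y = y.
  by rewrite /symm (big_pred1 1%g) ?chi1 ?act1 ?scale1r.
have [|c0 [g [u0 cext]]] := @exists_extremal true id0 x 1%g; first by rewrite act1 symm0.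
have [|t [h [y0 text]]] := @exists_extremal false id0 (symm true c0 (act g x)) 1%g.
  by rewrite act1 symm0.
(* The translation by [h] that comes with [t] is absorbed into the column map: [c] is [c0] composed
   with the inverse of [h]. *)
have := extremal_act h cext.
move: y0 text; rewrite act_symm actM; set c := finfun _.
set v := symm true c _ => y0 text cextv.
exists t, c, (g * h)%g; split=> //.
(* If [a] and [b] shared both row and column, their transposition would negate the antisymmetrized
   vector while leaving its row symmetrization unchanged, so the latter would equal its own
   opposite. *)
- move=> a b [tab cab]; apply/eqP/negPn/negP => ab; case/negP: y0; apply/eqP.
  have /(congr1 (symm false t)) := cextv.1 _ (stab_tperm cab).
  rewrite symm_act ?stab_tperm // /chi odd_tperm ab /= expr0 expr1 scale1r scaleN1r.
  rewrite linearN => /eqP; rewrite -addr_eq0 -mulr2n => /eqP /(mulrn_char0 char0).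
  by apply.
- have E1 := transpositionsE text; have E2 := transpositionsE cextv.
  (* The row symmetrizer commutes with [transpositions], so the column formula passes to the
     row-symmetrized vector and can be compared there with the row formula. *)
  move/(congr1 (symm false t)): E2; rewrite linearD /= -transpositions_symm.
  rewrite !linearZ /= !linearMn /=; move: E1; rewrite !expr0 !expr1 !scale1r !scaleN1r.
  set y := symm false t v in y0 * => E1 E2.
  have : y *+ (same_pairs t + same_pairs c) - y *+ (min_pairs t + min_pairs c) = 0.
    rewrite !mulrnDr -E1; move: E2; rewrite !mulNrn => /(congr1 -%R).
    rewrite opprK opprB => <-.
    by rewrite [transpositions y + _]addrC [_ - transpositions y]addrC addrA addrK subrr.
  case: (ltngtP (same_pairs t + same_pairs c)%N (min_pairs t + min_pairs c)%N) => // lt.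
    rewrite -opprB => /eqP; rewrite oppr_eq0 -mulrnBr ?(ltnW lt) // => /eqP.
    by move/(mulrn_char0 char0); rewrite subn_gt0 => /(_ lt) E; rewrite E eqxx in y0.
  rewrite -mulrnBr ?(ltnW lt) //.
  by move/(mulrn_char0 char0); rewrite subn_gt0 => /(_ lt) E; rewrite E eqxx in y0.
Qed.
End Symmetrizers.

(** * Young tableaux from nested rows *)

Section Shape.
Variable n : nat.
Implicit Types t c : {ffun 'I_n -> 'I_n}.

Lemma sorting_perm (f : 'I_n -> nat) :
  exists s : {perm 'I_n}, forall i j, (s i <= s j)%N -> (f j <= f i)%N.
Proof.
pose leT i j := (f j <= f i)%N; pose l := sort leT (enum 'I_n).
have meml i : i \in l by rewrite mem_sort mem_enum.
have lt i : (index i l < n)%N.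
  by rewrite -{2}(size_enum_ord n) -(size_sort leT) index_mem.
have inj : injective (fun i => Ordinal (lt i)).
  by move=> i j [/(congr1 (nth i l))]; rewrite !nth_index.
exists (perm inj) => i j; rewrite !permE /=.
apply: (@sorted_leq_index _ leT) => //.
- by move=> x y z; rewrite /leT => h1 h2; apply: leq_trans h2 h1.
- by move=> x; apply: leqnn.
- by apply: sort_sorted => x y; apply: leq_total.
Qed.

(** The zeros of a decreasing sequence come last, so deleting them shifts no other entry, and the
    default value [0] replaces them. An [int_partition] has no zero parts. *)
Lemma nth_filter_neq0 (s : seq nat) k :
  sorted geq s -> nth 0 (filter (predC1 0) s) k = nth 0 s k.
Proof.
elim: s k => //= x s IH k hs; have hs' := path_sorted hs.
case: (eqVneq x 0%N) hs => [-> hs|x0 _] /=; last by case: k => //= k; exact: IH.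
have all0 j : nth 0 s j = 0%N.
  case: (ltnP j (size s)) => [lt|ge]; last by rewrite nth_default.
  have tr : transitive geq by move=> a b d h1 h2; apply: leq_trans h2 h1.
  have /allP/(_ _ (mem_nth 0 lt)) := order_path_min tr hs.
  by rewrite /geq /= leqn0 => /eqP.
by rewrite IH // all0; case: k => //= k; rewrite all0.
Qed.

Definition row_cols t c i : {set 'I_n} := [set c a | a in [set a | t a == i]].

Lemma mem_row_cols t c i j :
  reflect (exists2 a, t a = i & c a = j) (j \in row_cols t c i).
Proof.
apply: (iffP imsetP) => [[a]|[a ta <-]].
  by rewrite inE => /eqP ta ->; exists a.
by exists a => //; rewrite inE ta.
Qed.

Section Injective.
Variables t c : {ffun 'I_n -> 'I_n}.
Hypothesis inj : injective (fun a => (t a, c a)).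

Lemma inj_in_row i : {in [set a | t a == i] &, injective c}.
Proof.
by move=> a b; rewrite !inE => /eqP ta /eqP tb cab; apply: inj; rewrite ta tb cab.
Qed.

Lemma card_row_cols i : #|row_cols t c i| = fiber_size t i.
Proof. by rewrite card_in_imset //; apply: inj_in_row. Qed.

(** By injectivity two distinct entries of one column lie in different rows, and for two given rows
    such pairs correspond to the columns that both rows meet. *)
Lemma same_pairs_row_cols :
  (same_pairs c = \sum_i \sum_(j | j != i) #|row_cols t c i :&: row_cols t c j|)%N.
Proof.
rewrite /same_pairs (partition_big t xpredT) //=; apply: eq_bigr => i _.
transitivity (\sum_(a | t a == i) \sum_(j | j != i) (c a \in row_cols t c j))%N.
  apply: eq_bigr => a /eqP ta.
  rewrite (bigID (fun b => t b == i)) /= big1 ?add0n => [|b /andP[ba /eqP tb]]; last first.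
    apply/eqP; rewrite eqb0; apply: contraNneq ba => cab; apply/eqP/inj.
    by rewrite ta tb cab.
  rewrite (partition_big t (fun j => j != i)) /=; last by move=> b /andP[].
  apply: eq_bigr => j ji; case: mem_row_cols => [[b tb cb]|no].
    rewrite (bigD1 b) /= ?tb ?ji ?eqxx ?andbT; last first.
      by apply: contraNneq ji => E; rewrite -tb E ta.
    rewrite cb eqxx big1 // => b' /andP[/andP[_ /eqP tb'] b'b].
    apply/eqP; rewrite eqb0; apply: contraNneq b'b => cab; apply/eqP/inj.
    by rewrite tb' tb cab cb.
  rewrite big1 // => b /andP[_ /eqP tb]; apply/eqP; rewrite eqb0.
  by apply/eqP => cb; apply: no; exists b.
rewrite exchange_big; apply: eq_bigr => j ji /=.
rewrite -big_mkcondr sum1_card.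
transitivity #|[set a | (t a == i) && (c a \in row_cols t c j)]|.
  by rewrite cardsE.
rewrite -(@card_in_imset _ _ c).
  apply/eq_card => d; rewrite !inE; apply/imsetP/andP => [[a]|[]].
    by rewrite inE => /andP[/eqP ta hc] ->; split=> //; apply/mem_row_cols; exists a.
  move/mem_row_cols => [a ta <-] h; exists a => //.
  by rewrite inE ta eqxx.
move=> a b; rewrite !inE => /andP[ha _] /andP[hb _].
by apply: (@inj_in_row i); rewrite inE.
Qed.

(** Two rows share at most as many columns as the shorter one meets, with equality exactly when one
    of the two column sets contains the other. *)
Lemma same_pairs_leqif : (same_pairs c <= min_pairs t ?= iff
  [forall i, forall j, (j != i) ==>
    (#|row_cols t c i :&: row_cols t c j| == minn (fiber_size t i) (fiber_size t j))])%N.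
Proof.
rewrite same_pairs_row_cols; apply: leqif_sum => i _; apply: leqif_sum => j ji.
split=> //; rewrite leq_min -!card_row_cols.
by rewrite !subset_leq_card ?subsetIl ?subsetIr.
Qed.

End Injective.

(** Relabel rows and columns by decreasing size. Suppose column [j'] comes before column [j], and
    row [i] meets [j] but not [j']. By nestedness every row meeting [j'] contains row [i] and so
    meets [j], which makes column [j'] strictly smaller than column [j], against the ordering. So
    each row occupies an initial segment of columns. *)
Lemma nested_tableau t c : injective (fun a => (t a, c a)) ->
  (forall i j, row_cols t c i \subset row_cols t c j \/
               row_cols t c j \subset row_cols t c i) ->
  exists (mu : int_partition n) (T : tableau n),
  [/\ is_tableau mu T, stab (tabloid_of T) = stab t & col_stab T = stab c].
Proof.
move=> inj nested; have inj' : injective (fun a => (c a, t a)).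
  by move=> x y [cx tx]; apply: inj; rewrite cx tx.
have [s hs] := sorting_perm (fiber_size t); have [s' hs'] := sorting_perm (fiber_size c).
pose l := [seq fiber_size t ((s^-1)%g k) | k <- enum 'I_n].
have sl : size l = n by rewrite size_map size_enum_ord.
have nthl (k : 'I_n) : nth 0 l k = fiber_size t ((s^-1)%g k).
  by rewrite (nth_map k) ?size_enum_ord // nth_ord_enum.
have lsort : sorted geq l.
  apply/(sortedP 0) => k; rewrite sl => lt.
  have lt' : (k < n)%N by apply: ltnW.
  rewrite (nthl (Ordinal lt)) (nthl (Ordinal lt')); apply: hs.
  by rewrite !permKV /=.
have muP : [&& sorted geq (filter (predC1 0) l), 0%N \notin filter (predC1 0) l
    & sumn (filter (predC1 0) l) == n].
  apply/and3P; split.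
  - by apply: sorted_filter lsort => a b d h1 h2; apply: leq_trans h2 h1.
  - by rewrite mem_filter.
  - have -> : sumn (filter (predC1 0) l) = sumn l.
      by elim: l {nthl sl lsort} => //= x l IH; case: eqP => [->|_] /=; rewrite IH.
    rewrite sumnE big_map big_enum /= (reindex_inj (@perm_inj _ s)) /=.
    under eq_bigr do rewrite permK /fiber_size -sum1_card.
    rewrite -[X in _ == X]card_ord -sum1_card; apply/eqP.
    rewrite [RHS](partition_big t xpredT) //=.
    by apply: eq_bigr => i _; apply: eq_bigl => a; rewrite inE.
exists (IntPartition muP); exists [ffun a => (s (t a), s' (c a))]; split.
- apply/andP; split.
    apply/injectiveP => a b; rewrite !ffunE => -[/perm_inj ta /perm_inj ca].
    by apply: inj; rewrite ta ca.
  apply/forallP => a; rewrite ffunE /= nth_filter_neq0 // nthl permK.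
  rewrite -(card_row_cols inj); set i := t a; set j := c a.
  have ji : j \in row_cols t c i by apply/mem_row_cols; exists a.
  rewrite (cardsD1 j) ji add1n ltnS.
  have E : #|[set j' | (s' j' < s' j)%N]| = s' j.
    rewrite (_ : [set j' | _] = s' @^-1: [set x : 'I_n | (x < s' j)%N]); last first.
      by apply/setP => x; rewrite !inE.
    rewrite card_preimset; last exact: perm_inj.
    rewrite -sum1_card (eq_bigl (fun x : 'I_n => x < s' j)%N); last by move=> x; rewrite inE.
    by rewrite (big_ord_narrow (ltnW (ltn_ord _))) sum1_card card_ord.
  rewrite -{1}E; apply/subset_leq_card/subsetP => j'; rewrite !inE => lt.
  have j'j : j' != j by apply: contraTneq lt => ->; rewrite ltnn.
  rewrite j'j /=; apply/negPn/negP => nj'.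
  have := hs' _ _ (ltnW lt); apply/negP; rewrite -ltnNge.
  rewrite -!(card_row_cols inj'); apply/proper_card/properP; split.
    apply/subsetP => i' /mem_row_cols [b cb tb].
    have j'i' : j' \in row_cols t c i' by apply/mem_row_cols; exists b.
    case: (nested i i') => /subsetP sub; last by rewrite (sub _ j'i') in nj'.
    by have /mem_row_cols [d td cd] := sub _ ji; apply/mem_row_cols; exists d.
  exists i; first by apply/mem_row_cols; exists a.
  by apply/mem_row_cols => -[b cb tb]; case/negP: nj'; apply/mem_row_cols; exists b.
- apply/setP => g; apply/stabP/stabP => h a; have := h a; rewrite !ffunE /=.
    by move/perm_inj.
  by move->.
- apply/setP => g; rewrite !inE; apply: eq_forallb => a; rewrite !ffunE /=.
  by rewrite (inj_eq perm_inj).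
Qed.
End Shape.

(** * Existence of a Young symmetrizer not killing a given module *)

Section Young.
Variables (k : fieldType) (n : nat) (W : lmodType k).
Hypothesis char0 : [pchar k] =i pred0.
Variable act : {perm 'I_n} -> {linear W -> W}.
Hypothesis act1 : forall x, act 1%g x = x.
Hypothesis actM : forall s t x, act s (act t x) = act (t * s)%g x.

(** Rows and columns each give an inequality [same_pairs <= min_pairs], with the roles of [t] and
    [c] crossed. The two sides have equal totals, so both inequalities are equalities and the rows
    are nested. *)
Lemma exists_young_symmetrizer x : x != 0 ->
  exists (mu : int_partition n) (T : tableau n) (g : {perm 'I_n}),
    is_tableau mu T /\
    \sum_(s in stab (tabloid_of T)) act s
      (\sum_(h in col_stab T) (-1) ^+ h *: act h (act g x)) != 0.
Proof.
move=> x0; have [t [c [g [nz inj E]]]] := exists_contents_eq char0 act1 actM x0.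
have inj' : injective (fun a => (c a, t a)).
  by move=> a b [ca ta]; apply: inj; rewrite ca ta.
have L1 := same_pairs_leqif inj; have L2 := same_pairs_leqif inj'.
have /eqP : same_pairs c = min_pairs t.
  by have := L1.1; have := L2.1; move: E; lia.
rewrite L1.2 => /forallP nest.
have [|mu [T [hT st sc]]] := nested_tableau inj.
  move=> i j; case: (eqVneq j i) => [->|ji]; first by left.
  have /forallP/(_ j)/implyP/(_ ji)/eqP := nest i.
  rewrite -!(card_row_cols inj); case: leqP => [_|_] h; [left|right].
    by apply/setIidPl/eqP; rewrite eqEcard subsetIl h leqnn.
  by apply/setIidPr/eqP; rewrite eqEcard subsetIr h leqnn.
exists mu, T, g; split=> //; move: nz; rewrite /symm st sc.
by under eq_bigr do rewrite /chi /= expr0 scale1r.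
Qed.
End Young.

(** * Garnir relations *)

Lemma sum_nth_le (s : seq nat) n : (\sum_(i < n) nth 0 s i <= sumn s)%N.
Proof.
elim: s n => [|x s IH] [|n] /=; rewrite ?big_ord0 //.
  by rewrite big1 // => i _; rewrite nth_nil.
by rewrite big_ord_recl /= leq_add2l IH.
Qed.

Lemma card_ord_lt n m : (#|[pred c : 'I_n | (c < m)%N]| <= m)%N.
Proof.
rewrite -{2}(size_iota 0 m) cardE -(size_map val); apply: uniq_leq_size.
  by rewrite map_inj_uniq ?enum_uniq //; exact: val_inj.
by move=> x /mapP [c]; rewrite mem_enum inE => lt ->; rewrite mem_iota.
Qed.

Section Tableaux.
Variable n : nat.
Variables (mu : int_partition n) (T : tableau n).
Hypothesis hT : is_tableau mu T.

Lemma tableau_inj : injective T.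
Proof. by case/andP: hT => /injectiveP. Qed.

Lemma tableau_cell a : ((T a).2 < nth 0 mu (T a).1)%N.
Proof. by case/andP: hT => _ /forallP. Qed.

Lemma parts_antitone i j : (i <= j)%N -> (nth 0 mu j <= nth 0 mu i)%N.
Proof.
case/and3P: (partsP mu) => hs _ _ le.
case: (ltnP j (size mu)) => [lt|ge]; last by rewrite nth_default.
have tr : transitive geq by move=> a b d h1 h2; apply: leq_trans h2 h1.
have := @sorted_leq_nth _ geq tr leqnn 0 mu hs i j.
by rewrite !inE; apply => //; apply: leq_ltn_trans lt.
Qed.

(** The [n] entries inject into a diagram with at most [n] cells, hence fill it. *)
Lemma tableau_surj (r c : 'I_n) : (c < nth 0 mu r)%N -> exists a, T a = (r, c).
Proof.
pose cells := [set x : 'I_n * 'I_n | (x.2 < nth 0 mu x.1)%N].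
have sub : [set T a | a in 'I_n] \subset cells.
  by apply/subsetP => x /imsetP [a _ ->]; rewrite inE tableau_cell.
have le : (#|cells| <= n)%N.
  have -> : #|cells| = (\sum_(r < n) \sum_(c < n) (c < nth 0 mu r))%N.
    rewrite pair_big /= -sum1_card big_mkcond /=.
    by apply: eq_bigr => x _; rewrite inE; case: (_ < _)%N.
  apply: leq_trans (_ : (\sum_(i < n) nth 0 mu i <= _)%N); last first.
    by apply: leq_trans (sum_nth_le _ _) _; case/and3P: (partsP mu) => _ _ /eqP ->.
  apply: leq_sum => i _; rewrite -big_mkcond sum1_card.
  exact: card_ord_lt.
have /eqP E : [set T a | a in 'I_n] == cells.
  by rewrite eqEcard sub card_imset ?card_ord //; apply: tableau_inj.
move=> h; have : (r, c) \in cells by rewrite inE.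
by rewrite -E => /imsetP [a _ ->]; exists a.
Qed.

(* The rows met by the entries [A] of the first column at or below row [i] and by
   the entries [B] of the second one at or above row [i] all occur in the first
   column, which has fewer than [#|A| + #|B|] cells. *)
Lemma garnir_collision a b (s : {perm 'I_n}) :
  (T a).1 = (T b).1 -> ((T a).2 < (T b).2)%N -> s \in col_stab T ->
  let A := [set x | ((T x).2 == (T a).2) && ((T a).1 <= (T x).1)%N] in
  let B := [set x | ((T x).2 == (T b).2) && ((T x).1 <= (T a).1)%N] in
  exists x y, [/\ x \in A :|: B, y \in A :|: B, x != y
                & (T ((s^-1)%g x)).1 = (T ((s^-1)%g y)).1].
Proof.
rewrite inE => rows cols /forallP hs A B; pose f x := (T ((s^-1)%g x)).1.
have hsV x : (T ((s^-1)%g x)).2 = (T x).2 by rewrite -(eqP (hs _)) permKV.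
pose Cj := [set y | (T y).2 == (T a).2]; pose R := [set (T y).1 | y in Cj].
have subR : f @: (A :|: B) \subset R.
  apply/subsetP => r /imsetP [x + ->]; rewrite inE => /orP[]; rewrite inE.
    by case/andP => cx _; apply: imset_f; rewrite inE hsV.
  case/andP => cx _; have := tableau_cell ((s^-1)%g x); rewrite hsV (eqP cx) => lt.
  have [y Ty] := tableau_surj (ltn_trans cols lt).
  by apply/imsetP; exists y; rewrite ?inE Ty.
pose A' := Cj :\: A.
have cA : #|Cj| = (#|A| + #|A'|)%N.
  rewrite -(cardsID A Cj); congr (_ + _)%N; apply: eq_card => x; rewrite !inE.
  by case: eqP.
(* A row above that of [a] is at least as long as the row of [b], so it also meets the second
   column, in an entry of [B] other than [b]. *)
have leA' : (#|A'| <= #|B :\ b|)%N.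
  have <- : #|[set (T y).1 | y in A']| = #|A'|.
    rewrite card_in_imset // => x y; rewrite !inE => /andP[_ /eqP cx] /andP[_ /eqP cy] E.
    by apply: tableau_inj; rewrite [T x]surjective_pairing [T y]surjective_pairing E cx cy.
  apply: leq_trans (leq_imset_card (fun y => (T y).1) (B :\ b)).
  apply/subset_leq_card/subsetP => r /imsetP [y].
  rewrite !inE => /andP[+ cy]; rewrite cy /= -ltnNge => lt ->.
  have : ((T b).2 < nth 0 mu (T y).1)%N.
    apply: leq_trans (tableau_cell b) _; apply: parts_antitone.
    by rewrite -rows ltnW.
  move=> /tableau_surj [z Tz]; apply/imsetP; exists z; rewrite ?Tz //.
  rewrite !inE Tz /= eqxx (ltnW lt) !andbT.
  by apply: contraTneq lt => E; rewrite rows -E Tz ltnn.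
have disj : [disjoint A & B].
  rewrite disjoint_subset; apply/subsetP => x; rewrite !inE => /andP[/eqP -> _].
  by rewrite -val_eqE /= ltn_eqF.
have lt : (#|R| < #|A :|: B|)%N.
  apply: leq_ltn_trans (leq_imset_card _ _) _.
  rewrite cA cardsU disjoint_setI0 // cards0 subn0 ltn_add2l.
  by apply: leq_ltn_trans leA' _; rewrite [X in (_ < X)%N](cardsD1 b) !inE eqxx rows leqnn.
case: (boolP [exists x in A :|: B, exists y in A :|: B, (x != y) && (f x == f y)]).
  by case/exists_inP => x hx /exists_inP [y hy /andP[xy /eqP E]]; exists x, y.
move/negP => no; have inj : {in A :|: B &, injective f}.
  move=> x y hx hy E; apply/eqP/negPn/negP => xy; apply: no.
  by apply/exists_inP; exists x => //; apply/exists_inP; exists y; rewrite ?xy ?E ?eqxx.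
by have := subset_leq_card subR; rewrite card_in_imset // leqNgt lt.
Qed.
End Tableaux.

Section Garnir.
Variables (k : fieldType) (n : nat).
Hypothesis char0 : [pchar k] =i pred0.
Implicit Types T : tableau n.

Lemma tabloid_actM s h (t : tabloid n) :
  tabloid_act s (tabloid_act h t) = tabloid_act (h * s)%g t.
Proof. by apply/ffunP => a; rewrite !ffunE invMg permM. Qed.

Lemma polytabloid_act s T : s \in col_stab T ->
  polytabloid k (tableau_act s T) = (-1) ^+ s *: polytabloid k T.
Proof.
rewrite inE => /forallP hs; rewrite -tabmod_act_polytabloid /polytabloid.
rewrite linear_sum scaler_sumr /= [RHS](reindex_inj (mulIg s)) /=.
apply: eq_big => [h|h _].
  rewrite !inE; apply: eq_forallb => a; rewrite permM.
  by rewrite (eqP (hs _)).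
rewrite linearZ /= tabmod_act_tabvec tabloid_actM scalerA odd_permM.
by rewrite signr_addb mulrCA -signr_addb addbb mulr1.
Qed.

(** Precomposing with the transposition of [a] and [b] fixes the tabloid and reverses the sign, so
    the sum equals its own opposite. *)
Lemma sum_sign_eq0 (X : {set 'I_n}) (t : tabloid n) a b :
  a \in X -> b \in X -> a != b -> t a = t b ->
  \sum_(s | perm_on X s) (-1) ^+ s *: tabvec k (tabloid_act s t) = 0.
Proof.
move=> aX bX ab tab; set S := \sum_(s | _) _.
suff E : S = - S.
  apply: (mulrn_char0 char0 (m := 2)) => //; rewrite mulr2n {1}E addNr //.
rewrite {1}/S (reindex_inj (mulgI (tperm a b))) /= /S -sumrN.
have pon : perm_on X (tperm a b).
  apply/subsetP => x; rewrite inE; case: tpermP => [->|->|] //; rewrite ?eqxx //.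
apply: eq_big => [s|s _].
  apply/idP/idP => [h|h]; last exact: perm_onM.
  by rewrite -(mulKg (tperm a b) s) tpermV; apply: perm_onM.
rewrite odd_mul_tperm ab addTb signrN scaleNr -tabloid_actM; congr (- (_ *: tabvec k (tabloid_act s _))).
apply/ffunP => x; rewrite !ffunE tpermV; case: tpermP => [->|->|] //.
Qed.

(** Expand the polytabloids and sum first over the permutations of [X]: each column permutation of
    [T] gives a tabloid with two entries of [X] in one row, and its alternating sum vanishes. *)
Lemma garnir_relation T (X : {set 'I_n}) :
  (forall s, s \in col_stab T -> exists a b,
     [/\ a \in X, b \in X, a != b & (T ((s^-1)%g a)).1 = (T ((s^-1)%g b)).1]) ->
  \sum_(s | perm_on X s) (-1) ^+ s *: polytabloid k (tableau_act s T) = 0.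
Proof.
move=> coll.
under eq_bigr => s _ do rewrite -tabmod_act_polytabloid /polytabloid linear_sum scaler_sumr.
rewrite exchange_big big1 //= => h hh.
have [a [b [aX bX ab E]]] := coll h hh.
under eq_bigr => s _ do rewrite linearZ /= tabmod_act_tabvec scalerA mulrC -scalerA.
rewrite -scaler_sumr (@sum_sign_eq0 X _ a b) ?scaler0 //.
by rewrite !ffunE.
Qed.

Definition col_potential T : nat := (\sum_(x < n) x * (T x).2)%N.
Definition row_potential T : nat := (\sum_(x < n) x * (T x).1)%N.

Lemma col_potential_act T s :
  (col_potential (tableau_act s T) = \sum_(x < n) s x * (T x).2)%N.
Proof.
rewrite /col_potential (reindex_inj (@perm_inj _ s)).
by apply: eq_bigr => x _; rewrite ffunE permK.
Qed.

Lemma row_potential_act T s :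
  (row_potential (tableau_act s T) = \sum_(x < n) s x * (T x).1)%N.
Proof.
rewrite /row_potential (reindex_inj (@perm_inj _ s)).
by apply: eq_bigr => x _; rewrite ffunE permK.
Qed.

(* Exchanging small entries of [B] with larger ones of [A], to the left of [B],
   increases the weight of the larger column index. *)
Lemma col_potential_garnir T a b (s : {perm 'I_n}) (A B : {set 'I_n}) :
  ((T a).2 < (T b).2)%N -> (b < a)%N ->
  {in A, forall x, (T x).2 = (T a).2 /\ (a <= x)%N} ->
  {in B, forall x, (T x).2 = (T b).2 /\ (x <= b)%N} ->
  perm_on (A :|: B) s -> s \notin col_stab T ->
  (col_potential T < col_potential (tableau_act s T))%N.
Proof.
move=> cols ba hA hB hs ns; rewrite col_potential_act /col_potential.
have fixs x : x \notin A :|: B -> s x = x by exact: out_perm.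
have sB x : x \in A :|: B -> s x \in A :|: B by rewrite (perm_closed _ hs).
(* On [A :|: B] every entry has the column weight of [a], plus the difference of the two columns
   when it lies in [B]. The first contribution is invariant under [s], so only the sum over [B] has
   to be compared. *)
have sum_in (f : 'I_n -> 'I_n) : (\sum_(x in A :|: B) f x * (T x).2 =
    \sum_(x in A :|: B) f x * (T a).2 + ((T b).2 - (T a).2) * \sum_(x in B) f x)%N.
  rewrite big_distrr /= [in X in (_ + X)%N]big_mkcond /=.
  rewrite [X in (_ + X)%N](bigID (mem (A :|: B))) /= [X in (_ + (_ + X))%N]big1 ?addn0.
    rewrite -big_split; apply: eq_bigr => x; rewrite inE /=.
    case: (boolP (x \in B)) => [/hB [-> _] _|_]; last by rewrite orbF addn0 => /hA [-> _].
    by rewrite [((_ - _) * _)%N]mulnC -mulnDr subnKC // ltnW.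
  by move=> x; rewrite inE; case: (x \in B) => //; rewrite orbT.
have sum_s : (\sum_(x in A :|: B) s x * (T a).2 = \sum_(x in A :|: B) x * (T a).2)%N.
  rewrite [RHS](reindex_inj (@perm_inj _ s)) /=; apply: eq_bigl => x.
  by rewrite (perm_closed _ hs).
rewrite (bigID (mem (A :|: B))) /= [X in (_ < X)%N](bigID (mem (A :|: B))) /=.
rewrite [X in (_ < _ + X)%N](eq_bigr (fun x : 'I_n => x * (T x).2)%N) => [|x /fixs -> //].
rewrite ltn_add2r (sum_in s) (sum_in id) sum_s ltn_add2l ltn_pmul2l ?subn_gt0 //.
have -> : (\sum_(x in B) s x = \sum_(y in s @: B) y)%N.
  by rewrite big_imset //= => x y _ _; exact: perm_inj.
(* The common part of [B] and its image cancels. Equally many entries are lost, all at most [b], as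
   are gained, all at least [a > b]; some are lost because [s] does not preserve the columns. *)
rewrite (big_setID (s @: B)) [X in (_ < X)%N](big_setID B) /= setIC ltn_add2l.
have ED : #|s @: B :\: B| = #|B :\: s @: B|.
  have := cardsID B (s @: B); rewrite card_imset; last exact: perm_inj.
  by rewrite -(cardsID (s @: B) B) setIC => /addnI.
have pos : (0 < #|B :\: s @: B|)%N.
  rewrite lt0n cards_eq0 setD_eq0; apply: contra ns => sub.
  have EB : s @: B = B.
    by apply/esym/eqP; rewrite eqEcard sub card_imset ?leqnn //; exact: perm_inj.
  have memB x : (s x \in B) = (x \in B) by rewrite -{1}EB mem_imset //; exact: perm_inj.
  rewrite inE; apply/forallP => x; case: (boolP (x \in A :|: B)) => [hx|/fixs -> //].
  have := sB _ hx; case: (boolP (x \in B)) (hx) => xB.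
    by have := xB; rewrite -memB => /hB [-> _] _ _; rewrite (hB _ xB).1.
  rewrite !in_setU memB (negbTE xB) !orbF => /hA [-> _] /hA [-> _].
  by [].
apply: (@leq_ltn_trans (\sum_(x in B :\: s @: B) b)%N).
  by apply: leq_sum => x; rewrite inE => /andP[_ /hB []].
apply: (@leq_trans (\sum_(x in s @: B :\: B) a)%N).
  by rewrite !sum_nat_const ED ltn_pmul2l.
apply: leq_sum => x; rewrite inE => /andP[xB /imsetP [y yB E]].
have : x \in A :|: B by rewrite E sB // inE yB orbT.
by rewrite inE (negbTE xB) orbF => /hA [].
Qed.

(** This bound makes [n * n * n + 1] a valid base for a lexicographic combination with
    [row_potential] as the lower digit. *)
Lemma row_potential_lt T : (row_potential T < n * n * n + 1)%N.
Proof.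
rewrite addn1 ltnS /row_potential -mulnA; apply: (@leq_trans (\sum_(x < n) n * n)%N).
  by apply: leq_sum => x _; rewrite leq_mul // ltnW.
by rewrite sum_nat_const card_ord.
Qed.

(* Sorting a column fixes [col_potential] and increases [row_potential]; a Garnir
   exchange increases [col_potential]. *)
Definition potential T : nat := (col_potential T * (n * n * n + 1) + row_potential T)%N.

Lemma potential_col T T' : (col_potential T < col_potential T')%N ->
  (potential T < potential T')%N.
Proof.
move=> lt; rewrite /potential; have := row_potential_lt T.
move: (row_potential T) (row_potential T') (n * n * n + 1)%N lt => x y z.
by move: (col_potential T) (col_potential T') => u v; nia.
Qed.

Definition standard_span (mu : int_partition n) : {vspace tabmod n k} :=
  <<[seq polytabloid k T | T <- enum (is_standard mu)]>>%VS.

(** Straightening, by induction on the distance of [potential] from its maximum [M]. A descent in a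
    column is removed by a transposition at the cost of a sign; once all columns increase, a descent
    in a row is handled by the Garnir relation, whose other terms have larger potential. *)
Lemma polytabloid_standard_span (mu : int_partition n) T :
  is_tableau mu T -> polytabloid k T \in standard_span mu.
Proof.
have [M hM] : exists M, forall T', (potential T' <= M)%N.
  by exists (\max_T' potential T')%N => T'; apply: leq_bigmax.
have [m] : exists m, (M < potential T + m)%N by exists M.+1; rewrite addnS ltnS leq_addl.
elim: m T => [|m IH] T lt hT; first by move: lt; rewrite addn0 ltnNge hM.
have IHs s : (potential T < potential (tableau_act s T))%N ->
    polytabloid k (tableau_act s T) \in standard_span mu.
  move=> lt'; apply: IH; last exact: is_tableau_act.
  by move: lt lt'; move: (potential _) (potential _) => p q; lia.
case: (boolP [forall a, forall b, ((T a).2 == (T b).2) && ((T a).1 < (T b).1)%N ==> (a < b)%N]); last first.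
  case/forallPn => a /forallPn [b]; rewrite negb_imply -leqNgt => /andP[/andP[/eqP cab rab] ba].
  have ab : a != b by apply: contraTneq rab => ->; rewrite ltnn.
  pose s := tperm a b; have hs : s \in col_stab T.
    by rewrite inE; apply/forallP => x; rewrite /s; case: tpermP => [->|->|_ _]; rewrite ?cab.
  have : polytabloid k (tableau_act s T) \in standard_span mu.
    apply: IHs; rewrite /potential.
    have -> : col_potential (tableau_act s T) = col_potential T.
      rewrite col_potential_act /col_potential [RHS](reindex_inj (@perm_inj _ s)).
      by apply: eq_bigr => x _; move: hs; rewrite inE => /forallP/(_ x)/eqP ->.
    rewrite ltn_add2l row_potential_act /row_potential (bigD1 a) //= (bigD1 b) 1?eq_sym //=.
    rewrite [X in (_ < X)%N](bigD1 a) //= [X in (_ < _ + X)%N](bigD1 b) 1?eq_sym //=.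
    rewrite !addnA tpermL tpermR.
    rewrite [X in (_ < _ + X)%N](eq_bigr (fun x : 'I_n => x * (T x).1)%N); last first.
      by move=> x /andP[xa xb]; rewrite tpermD // eq_sym.
    have lt_ba : (b < a)%N by rewrite ltn_neqAle ba andbT eq_sym.
    rewrite ltn_add2r; move: (nat_of_ord (T a).1) (nat_of_ord (T b).1) rab lt_ba => u v.
    by move: (nat_of_ord a) (nat_of_ord b) => p q; nia.
  by rewrite polytabloid_act // odd_tperm ab expr1 scaleN1r rpredN.
move=> colOK; have {}colOK a b : (T a).2 = (T b).2 -> ((T a).1 < (T b).1)%N -> (a < b)%N.
  by move=> e l; have /forallP/(_ a)/forallP/(_ b)/implyP := colOK; apply; rewrite e eqxx.
case: (boolP (is_standard mu T)) => [st|]; first by apply/memv_span/map_f; rewrite mem_enum.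
rewrite /is_standard hT => /forallPn [a /forallPn [b]].
rewrite negb_and !negb_imply -!leqNgt => /orP[]; last first.
  by case/andP => /andP[/eqP e l]; rewrite leqNgt colOK.
case/andP => /andP[/eqP rab cab] ba.
have ab : a != b by apply: contraTneq cab => ->; rewrite ltnn.
have lt_ba : (b < a)%N by rewrite ltn_neqAle ba andbT eq_sym.
pose A := [set x | ((T x).2 == (T a).2) && ((T a).1 <= (T x).1)%N].
pose B := [set x | ((T x).2 == (T b).2) && ((T x).1 <= (T a).1)%N].
have hA : {in A, forall x, (T x).2 = (T a).2 /\ (a <= x)%N}.
  move=> x; rewrite inE => /andP[/eqP cx]; rewrite leq_eqVlt => /orP[/eqP rx|rx]; split=> //.
    suff -> : x = a by [].
    by apply: (tableau_inj hT); rewrite [T x]surjective_pairing [T a]surjective_pairing cx (val_inj rx).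
  by rewrite ltnW // colOK.
have hB : {in B, forall x, (T x).2 = (T b).2 /\ (x <= b)%N}.
  move=> x; rewrite inE rab => /andP[/eqP cx]; rewrite leq_eqVlt => /orP[/eqP rx|rx]; split=> //.
    suff -> : x = b by [].
    by apply: (tableau_inj hT); rewrite [T x]surjective_pairing [T b]surjective_pairing cx (val_inj rx).
  by rewrite ltnW // colOK.
have := @garnir_relation T (A :|: B) (fun s hs => garnir_collision hT rab cab hs).
(* In the terms that preserve the columns the two signs cancel, leaving [N] copies of the
   polytabloid itself; [N] is invertible in characteristic 0. *)
rewrite (bigID (mem (col_stab T))) /=.
rewrite (eq_bigr (fun _ => polytabloid k T)) => [|s /andP[_ hs]]; last first.
  by rewrite polytabloid_act // scalerA -signr_addb addbb scale1r.
rewrite sumr_const; set N := #|_|; set rest := \sum_(s | _) _ => /eqP.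
have restP : rest \in standard_span mu.
  apply: rpred_sum => s /andP[hs ns]; apply/rpredZ/IHs/potential_col.
  exact: (col_potential_garnir cab lt_ba hA hB).
rewrite addr_eq0 -scaler_nat => /eqP E.
have N0 : (N%:R : k) != 0.
  have /pcharf0P -> := char0; rewrite -lt0n; apply/card_gt0P; exists 1%g.
  by rewrite unfold_in perm_on1 inE; apply/forallP => x; rewrite perm1.
by rewrite -[polytabloid k T](scalerK N0) E rpredZ // rpredN.
Qed.
End Garnir.

(** * Uniqueness of the encoding *)

Definition linear_of (k : fieldType) (U V : lmodType k) (f : U -> V) (hf : linear f) :
    {linear U -> V} :=
  HB.pack_for {linear U -> V} f (GRing.isLinear.Build k U V *:%R f hf).

Section Places.
Variables (k : fieldType) (n : nat) (V : lmodType k).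
Local Notation functional := ({ffun 'I_n -> V} -> k^o).

(** The action is defined on the space of all functions of [n] vectors, which is readily an
    [lmodType] to which the existence of Young symmetrizers applies. *)
Definition permute_places (s : {perm 'I_n}) (M : functional) : functional :=
  fun v => M [ffun a => v (s a)].

Fact permute_places_linear s : linear (permute_places s).
Proof. by move=> a M N; apply/funext => v. Qed.
HB.instance Definition _ s :=
  GRing.isLinear.Build k functional functional _ (permute_places s)
    (permute_places_linear s).

Lemma permute_places1 M : permute_places 1 M = M.
Proof.
apply/funext => v; congr M; apply/ffunP => a; by rewrite ffunE perm1.
Qed.

Lemma permute_placesM s t M :
  permute_places s (permute_places t M) = permute_places (t * s)%g M.
Proof.
by apply/funext => v; congr M; apply/ffunP => a; rewrite !ffunE permM.
Qed.
End Places.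

Section Uniqueness.
Variables (k : fieldType) (n : nat) (V : lmodType k).
Hypothesis char0 : [pchar k] =i pred0.
Variable M : {ffun 'I_n -> V} -> k^o.
Hypothesis M_multilinear : multilinear M.

Lemma tlift_sum I r (P : pred I) (x : I -> tpow n V) :
  tlift M (\sum_(i <- r | P i) x i) = \sum_(i <- r | P i) tlift M (x i).
Proof. exact: (linear_sum (linear_of (tlift_linear M_multilinear))). Qed.

Lemma tliftZ a (x : tpow n V) : tlift M (a *: x) = a *: tlift M x.
Proof. exact: tlift_tscale. Qed.

(** Standard polytabloids span all polytabloids, and [psi] is linear; composing with the projection
    [vsproj] extends it to the whole tabloid space. *)
Lemma tlift_tableau_eq0 (mu : int_partition n) (f : schur mu V) (T : tableau n) :
  (forall T', is_standard mu T' -> tlift M (f (specht_polytabloid k mu T')) = 0) ->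
  is_tableau mu T -> tlift M (f (specht_polytabloid k mu T)) = 0.
Proof.
move=> std hT; have /asboolP [fl _] := schurP f.
pose psi y := tlift M (f (vsproj (specht k mu) y)).
have psi_lin : linear psi by move=> a x y; rewrite /psi linearP fl tlift_linear.
rewrite -[LHS]/(linear_of psi_lin (polytabloid k T)).
have := polytabloid_standard_span char0 hT; rewrite /standard_span => /coord_span ->.
rewrite linear_sum big1 // => i _; rewrite linearZ /=.
have : (i < size [seq polytabloid k T | T <- enum (is_standard mu)])%N.
  by rewrite size_map -cardE ltn_ord.
move=> /(mem_nth 0) /mapP [T' hT' ->]; rewrite mem_enum in hT'.
by rewrite [psi _]std ?scaler0.
Qed.

Section YoungMap.
Variables (mu : int_partition n) (t : tabloid n) (v : {ffun 'I_n -> V}).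

(** The equivariant map that sends the tabloid [t] to the sum of the translates of [tens v] under
    [stab t], and sends tabloids outside the orbit of [t] to zero. *)
Definition tabmod_map (y : tabmod n k) : tpow n V :=
  \sum_(p : {perm 'I_n}) (y (tabloid_act p t) : k) *: tens [ffun a => v ((p^-1)%g a)].

Fact tabmod_map_linear : linear tabmod_map.
Proof.
move=> a x y; rewrite /tabmod_map scaler_sumr -big_split; apply: eq_bigr => p _ /=.
by rewrite !ffunE scalerDl scalerA.
Qed.
HB.instance Definition _ :=
  GRing.isLinear.Build k (tabmod n k) (tpow n V) _ tabmod_map tabmod_map_linear.

Lemma tabmod_map_act s y : tabmod_map (tabmod_act s y) = tact s (tabmod_map y).
Proof.
rewrite linear_sum /tabmod_map [LHS](reindex_inj (mulIg s)) /=; apply: eq_bigr => p _.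
rewrite linearZ /= /tact (tlift_tens (tact_multilinear s)) ffunE tabloid_actM mulgK.
by congr (_ *: tens _); apply/ffunP => a; rewrite !ffunE invMg permM.
Qed.

Fact schur_of_tabmod_map_subproof :
  (fun x : subvs_of (specht k mu) => tabmod_map (vsval x)) \in schur_pred mu V.
Proof.
apply/asboolP; split=> [a x y|s x]; first by rewrite !linearP.
by rewrite specht_actE tabmod_map_act.
Qed.

Definition schur_of_tabmod_map : schur mu V := Defs.Schur schur_of_tabmod_map_subproof.

(** The permutations carrying [t] to a given translate form a coset of [stab t]; this produces a row
    symmetrizer of [M]. *)
Lemma tlift_tabmod_map_tabvec q c :
  tlift M (tabmod_map (tabmod_act q (tabvec k (tabloid_act c t)))) =
  \sum_(s in stab t) M [ffun a => v (s ((c^-1)%g ((q^-1)%g a)))].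
Proof.
rewrite tabmod_act_tabvec tabloid_actM /tabmod_map tlift_sum [LHS](reindex_inj (mulIg (c * q)%g)) /=.
rewrite [LHS](reindex_inj invg_inj) /= [RHS]big_mkcond; apply: eq_bigr => s _ /=.
rewrite tliftZ tlift_tens // !ffunE.
have -> : (tabloid_act (s^-1 * (c * q)) t == tabloid_act (c * q) t) = (s \in stab t).
  rewrite -(tabloid_actM _ (s^-1)%g); apply/eqP/stabP => [E a|h].
    have := congr1 (fun u : tabloid n => u ((c * q)%g a)) E.
    by rewrite !ffunE permK invgK.
  by congr tabloid_act; apply/ffunP => a; rewrite ffunE invgK.
case: (s \in stab t); last by rewrite scale0r.
rewrite scale1r; congr M; apply/ffunP => a.
by rewrite !ffunE !invMg invgK !permM.
Qed.
End YoungMap.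

(** Were [M] nonzero, some Young symmetrizer would not kill it. But the symmetrized function at [v]
    is the value of [M] on the image of a polytabloid under [schur_of_tabmod_map], which is zero by
    straightening. *)
Lemma multilinear_eq0 :
  (forall (mu : int_partition n) (T : tableau n) (f : schur mu V),
    is_standard mu T -> tlift M (f (specht_polytabloid k mu T)) = 0) ->
  forall v, M v = 0.
Proof.
move=> std; suff -> : M = (fun=> 0) by [].
apply: contrapT => /eqP M0.
have [mu [T [g [hT /eqP]]]] := exists_young_symmetrizer char0
  (@permute_places1 k n V) (@permute_placesM k n V) M0.
apply; apply/funext => v.
(* The translation by [g] is absorbed by relabelling the tableau. *)
have hT' := is_tableau_act (g^-1)%g hT.
have := @tlift_tableau_eq0 mu (schur_of_tabmod_map mu (tabloid_of T) v)
  (tableau_act (g^-1)%g T) (fun T' => std mu T' _) hT'.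
rewrite /= (specht_polytabloidE k hT') -tabmod_act_polytabloid /polytabloid.
rewrite (linear_sum (tabmod_act _)) (linear_sum (tabmod_map _ _)) tlift_sum.
move=> H; rewrite -[RHS]H {H} [RHS](reindex_inj invg_inj) /= fct_sumE.
transitivity (\sum_(s in stab (tabloid_of T)) \sum_(h in col_stab T)
  ((-1) ^+ h : k) *: (M [ffun a => v (s (h (g a)))] : k^o)).
  apply: eq_bigr => s _; rewrite linear_sum fct_sumE; apply: eq_bigr => h _.
  rewrite linearZ /= !permute_placesM scalrfctE; congr (_ *: M _).
  by apply/ffunP => a; rewrite !ffunE !permM.
rewrite exchange_big /=; apply: eq_big => [h|h _].
  rewrite !inE; apply/forallP/forallP => H a; first by rewrite -(eqP (H _)) permKV.
  by have := H (h a); rewrite permK eq_sym.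
rewrite !linearZ /= tliftZ -scaler_sumr odd_permV; congr (_ *: _).
by rewrite tlift_tabmod_map_tabvec !invgK.
Qed.
End Uniqueness.

(** * Prescribing the forms on a new vector *)

Section PartitionOfTableau.
Variable n : nat.

Lemma part_lt (mu : int_partition n) r : (0 < nth 0 mu r)%N ->
  (r < n)%N /\ (nth 0 mu r <= n)%N.
Proof.
case/and3P: (partsP mu) => _ no0 /eqP sm; case: (ltnP r (size mu)) => [lt|ge]; last first.
  by rewrite nth_default.
move=> _; split.
  apply: (leq_trans lt); rewrite -{2}sm; elim: (parts mu) no0 => //= x s IH.
  by rewrite inE negb_or eq_sym -lt0n => /andP[x0 /IH le]; rewrite -add1n leq_add.
rewrite -{2}sm; elim: (parts mu) r {no0 sm} lt => //= x s IH [|r] /= lt; first exact: leq_addr.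
by apply: leq_trans (IH _ lt) _; apply: leq_addl.
Qed.

(** The last cell of a row of [mu] is occupied by an entry of [T], hence lies in the diagram of [nu]
    too. *)
Lemma parts_le (mu nu : int_partition n) (T : tableau n) r :
  is_tableau mu T -> is_tableau nu T -> (nth 0 mu r <= nth 0 nu r)%N.
Proof.
move=> hm hn; case E : (nth 0 mu r) => [//|c].
have [lr lc] : (r < n)%N /\ (nth 0 mu r <= n)%N by apply: part_lt; rewrite E.
rewrite E in lc; have [|a Ta] := @tableau_surj _ _ _ hm (Ordinal lr) (Ordinal lc).
  by rewrite /= E.
by have := tableau_cell hn a; rewrite Ta.
Qed.

Lemma tableau_shape (mu nu : int_partition n) (T : tableau n) :
  is_tableau mu T -> is_tableau nu T -> mu = nu.
Proof.
move=> hm hn.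
have E r : nth 0 mu r = nth 0 nu r.
  by apply/eqP; rewrite eqn_leq (parts_le _ hm hn) (parts_le _ hn hm).
have sz (m1 m2 : int_partition n) : (forall r, nth 0 m1 r = nth 0 m2 r) -> (size m1 <= size m2)%N.
  move=> H; rewrite leqNgt; apply/negP => lt; case/and3P: (partsP m1) => _ /negP no0 _.
  by apply: no0; rewrite -[X in X \in _](nth_default 0 (leqnn (size m2))) -H mem_nth.
have : parts mu = parts nu.
  apply: (@eq_from_nth _ 0) => [|i _]; last exact: E.
  by apply/eqP; rewrite eqn_leq (sz _ _ E) (sz _ _ (fun r => esym (E r))).
by case: mu nu {hm hn E} => [m1 p1] [m2 p2] /= e; case: _ / e p2 => p2; rewrite (bool_irrelevance p1 p2).
Qed.
End PartitionOfTableau.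

Section Multilinear.
Variables (k : fieldType) (n : nat).

Lemma multilinear_comp (U V : lmodType k) (h : {linear U -> V})
    (m : {ffun 'I_n -> V} -> k^o) :
  multilinear m -> multilinear (fun v : {ffun 'I_n -> U} => m [ffun a => h (v a)]).
Proof.
move=> hm i v a x y.
have E z : [ffun j => h (upd v i z j)] = upd [ffun j => h (v j)] i (h z).
  by apply/ffunP => j; rewrite !ffunE; case: ifP.
by rewrite !E linearP; apply: hm.
Qed.

Lemma tlift_tmap (U V : lmodType k) (h : {linear U -> V}) (m : {ffun 'I_n -> V} -> k^o) x :
  multilinear m -> tlift m (tmap h x) = tlift (fun v => m [ffun a => h (v a)]) x.
Proof.
move=> hm; have hmh := multilinear_comp h hm.
pose f := linear_of (tlift_linear hm); pose g := linear_of (tlift_linear hmh).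
rewrite -[LHS]/(f _) -[RHS]/(g x) (tpow_span x) !(linear_sum (tmap h)) !linear_sum.
apply: eq_bigr => p _; rewrite linearZ_LR !linearZ /=; congr (_ *: _).
by rewrite /tmap (tlift_tens (tmap_multilinear h)) !tlift_tens.
Qed.

Lemma multilinearB (V : lmodType k) (m m' : {ffun 'I_n -> V} -> k^o) :
  multilinear m -> multilinear m' -> multilinear (fun v => m v - m' v : k^o).
Proof.
move=> hm hm' i v a x y; rewrite hm hm' scalerBr opprD addrACA //.
Qed.

Lemma tliftB (V : lmodType k) (m m' : {ffun 'I_n -> V} -> k^o) x :
  tlift (fun v => m v - m' v : k^o) x = tlift m x - tlift m' x.
Proof. by rewrite /tlift /teval -sumrB; apply: eq_bigr => p _; rewrite scalerBr. Qed.

Definition lin_comb (V : lmodType k) p (b : 'I_p -> V) (c : 'rV[k]_p) : V :=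
  \sum_l c 0 l *: b l.

Fact lin_comb_linear (V : lmodType k) p (b : 'I_p -> V) : linear (lin_comb b).
Proof.
move=> a x y; rewrite /lin_comb scaler_sumr -big_split; apply: eq_bigr => l _ /=.
by rewrite !mxE scalerDl scalerA.
Qed.
HB.instance Definition _ (V : lmodType k) p (b : 'I_p -> V) :=
  GRing.isLinear.Build k 'rV[k]_p V _ (lin_comb b) (lin_comb_linear b).

Definition unit_row p (l : 'I_p) : 'rV[k]_p := delta_mx 0 l.

Lemma lin_comb_unit_row (V : lmodType k) p (b : 'I_p -> V) l :
  lin_comb b (unit_row l) = b l.
Proof.
rewrite /lin_comb (bigD1 l) //= big1 ?addr0 => [|j jl]; rewrite mxE eqxx ?eqxx ?scale1r //.
by rewrite (negbTE jl) scale0r.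
Qed.

Lemma row_unit_rows p (c : 'rV[k]_p) : c = \sum_l c 0 l *: unit_row l.
Proof. exact: row_sum_delta. Qed.

Lemma multilinear_rV_eq0 p (m : {ffun 'I_n -> 'rV[k]_p} -> k^o) : multilinear m ->
  (forall J : {ffun 'I_n -> 'I_p}, m [ffun a => unit_row (J a)] = 0) -> forall v, m v = 0.
Proof.
move=> hm h0 v.
(* The list [s] contains the places that may hold arbitrary vectors; the induction expands them one
   at a time in unit rows. *)
suff H (s : seq 'I_n) (v' : {ffun 'I_n -> 'rV[k]_p}) : (forall a, a \notin s -> exists l, v' a = unit_row l) -> m v' = 0.
  by apply: (H (enum 'I_n)) => a; rewrite mem_enum.
elim: s v' => [|a s IH] v' hv.
  have [J hJ] := fin_all_exists (fun a => hv a isT).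
  rewrite -[RHS](h0 [ffun a => J a]); congr m.
  by apply/ffunP => a; rewrite !ffunE.
pose F := linear_of (hm a v').
have -> : m v' = F (v' a).
  by rewrite /=; congr m; apply/ffunP => j; rewrite ffunE; case: eqP => [->|].
rewrite (row_unit_rows (v' a)) linear_sum big1 // => l _.
rewrite linearZ /= IH ?scaler0 // => j js; rewrite ffunE; case: eqVneq => [_|ja].
  by exists l.
by apply: hv; rewrite inE negb_or ja.
Qed.

(** The multilinear form with prescribed array [g] of values on tuples of unit rows, as a Gram
    matrix prescribes a bilinear form. *)
Definition gram_form p (g : {ffun 'I_n -> 'I_p} -> k) (v : {ffun 'I_n -> 'rV[k]_p}) : k^o :=
  \sum_J g J * \prod_a v a 0 (J a).

Lemma gram_form_multilinear p (g : {ffun 'I_n -> 'I_p} -> k) : multilinear (gram_form g).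
Proof.
move=> i v a x y; rewrite /gram_form scaler_sumr -big_split; apply: eq_bigr => J _ /=.
have E z : \prod_j upd v i z j 0 (J j) = z 0 (J i) * \prod_(j | j != i) v j 0 (J j).
  rewrite (bigD1 i) //= ffunE eqxx; congr (_ * _).
  by apply: eq_bigr => j ji; rewrite ffunE (negbTE ji).
rewrite !E !mxE mulrDl mulrDr; congr (_ + _).
by rewrite /GRing.scale /= [RHS]mulrCA !mulrA.
Qed.

Lemma gram_form_unit_row p (g : {ffun 'I_n -> 'I_p} -> k) (J : {ffun 'I_n -> 'I_p}) :
  gram_form g [ffun a => unit_row (J a)] = g J.
Proof.
rewrite /gram_form (bigD1 J) //= [X in _ + X]big1 ?addr0 => [|J' ne].
  by rewrite big1 ?mulr1 // => a _; rewrite ffunE mxE !eqxx.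
have [a ha] : exists a, J' a != J a.
  by apply/existsP; rewrite -negb_forall; apply: contra ne => /forallP h; apply/eqP/ffunP => a; apply/eqP.
by rewrite (bigD1 a) //= ffunE mxE (negbTE ha) andbF mul0r mulr0.
Qed.

Lemma multilinear_rV_ext p (m m' : {ffun 'I_n -> 'rV[k]_p} -> k^o) :
  multilinear m -> multilinear m' ->
  (forall J : {ffun 'I_n -> 'I_p},
     m [ffun a => unit_row (J a)] = m' [ffun a => unit_row (J a)]) -> m =1 m'.
Proof.
move=> hm hm' h v; apply/eqP; rewrite -subr_eq0; apply/eqP.
by apply: (multilinear_rV_eq0 (multilinearB hm hm')) => J; rewrite h subrr.
Qed.

Lemma multilinear_lin_comb (V : lmodType k) p (b : 'I_p -> V) (m : {ffun 'I_n -> V} -> k^o)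
    (v : {ffun 'I_n -> 'rV[k]_p}) : multilinear m ->
  m [ffun a => lin_comb b (v a)] = gram_form (fun J => m [ffun a => b (J a)]) v.
Proof.
move=> hm; apply: (multilinear_rV_ext (multilinear_comp _ hm) (gram_form_multilinear _)) => J.
rewrite gram_form_unit_row; congr m; apply/ffunP => a.
by rewrite !ffunE /= lin_comb_unit_row.
Qed.
End Multilinear.

Section Encoding.
Variables (k : fieldType) (n : nat) (mu : int_partition n) (T : tableau n).
Hypothesis char0 : [pchar k] =i pred0.
Hypothesis T_standard : is_standard mu T.

Lemma encodes_pullback (U V : lmodType k) (h : {linear U -> V})
    (w : {linear schur mu V -> k^o}) (w' : {linear schur mu U -> k^o}) m :
  encodes T w m -> (forall f, w' f = w (schur_map h f)) ->
  encodes T w' (fun v => m [ffun a => h (v a)]).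
Proof.
move=> [hm enc kill] ww'; split; first exact: multilinear_comp.
  by move=> f; rewrite -tlift_tmap // ww' -enc.
by move=> nu T' f st ne; rewrite -tlift_tmap // -(kill nu T' (schur_map h f)).
Qed.

(** The difference of two encodings vanishes on every standard component: off [T] by the vanishing
    clause, and at [T], which determines its shape, because the forms agree. *)
Lemma encodes_unique (V : lmodType k) (w w' : {linear schur mu V -> k^o}) m m' :
  encodes T w m -> encodes T w' m' -> w =1 w' -> m =1 m'.
Proof.
move=> [hm enc kill] [hm' enc' kill'] ww' v; apply/eqP; rewrite -subr_eq0; apply/eqP.
apply: (multilinear_eq0 char0 (multilinearB hm hm')) => nu T' f st; rewrite tliftB.
case: (eqVneq T' T) => [E|ne]; last by rewrite kill ?kill' ?subrr.
have nm : nu = mu.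
  by apply: (@tableau_shape _ _ _ T); [rewrite E in st; case/andP: st | case/andP: T_standard].
by subst nu; rewrite E enc enc' ww' subrr.
Qed.
End Encoding.

Section LinearRange.
Variables (k : fieldType) (p : nat) (V : lmodType k) (f : {linear 'rV[k]_p -> V}).

Definition range_pred : {pred V} := fun v => `[< exists x, f x = v >].

Fact range_submod_closed : submod_closed range_pred.
Proof.
split; first by apply/asboolP; exists 0; rewrite linear0.
move=> a _ _ /asboolP[x <-] /asboolP[y <-]; apply/asboolP; exists (a *: x + y).
by rewrite linearP.
Qed.
HB.instance Definition _ :=
  GRing.isSubmodClosed.Build k V range_pred range_submod_closed.

Lemma range_predP v : v \in range_pred -> {x | f x = v}.
Proof. by move=> /asboolP /cid. Qed.

Fact to_range_subproof x : f x \in range_pred.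
Proof. by apply/asboolP; exists x. Qed.

Definition to_range (x : 'rV[k]_p) : subspace range_pred :=
  Subspace (to_range_subproof x).

(** A preimage taken by choice; injectivity of [f] makes it unique, and then maps built from it are
    linear. *)
Definition of_range (u : subspace range_pred) : 'rV[k]_p := sval (range_predP (subspaceP u)).

Lemma of_rangeK u : f (of_range u) = Defs.incl range_pred u.
Proof. exact: (svalP (range_predP (subspaceP u))). Qed.

Lemma finite_dim_range : finite_dim (subspace range_pred).
Proof.
exists p, (fun l => to_range (unit_row k l)) => u.
exists (fun l => of_range u 0 l); apply: val_inj.
rewrite -[val u]of_rangeK [in LHS](row_unit_rows (of_range u)) linear_sum.
rewrite -[RHS]/(Defs.incl range_pred _) (linear_sum (Defs.incl range_pred)); apply: eq_bigr => l _.
by rewrite linearZ (linearZ_LR (Defs.incl range_pred)).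
Qed.
End LinearRange.

Section Extension.
Variables (k : fieldType) (r : nat) (d : 'I_r -> nat).
Variables (lam : forall i : 'I_r, int_partition (d i)) (V : lmodType k).
Variables (w : forms lam V) (T : forall i : 'I_r, tableau (d i)).
Variable m : forall i : 'I_r, {ffun 'I_(d i) -> V} -> k^o.
Hypothesis char0 : [pchar k] =i pred0.
Hypothesis T_standard : forall i, is_standard (lam i) (T i).
Hypothesis m_encodes : forall i, encodes (T i) (w i) (@m i).
Hypothesis V_universal : universal w.
Hypothesis V_homogeneous : homogeneous w.

Lemma m_multilinear i : multilinear (@m i).
Proof. by case: (m_encodes i). Qed.

(** Homogeneity in coordinates: [f x] goes to [f' x], an isomorphism between the two ranges, which
    extends to an automorphism. Uniqueness of the encoding turns preservation of the [lam]-forms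
    into preservation of [m]. *)
Lemma extend_isometry p (f f' : {linear 'rV[k]_p -> V}) :
  injective f -> injective f' ->
  (forall i (x : {ffun 'I_(d i) -> 'rV[k]_p}),
     m [ffun a => f (x a)] = m [ffun a => f' (x a)]) ->
  exists s : {linear V -> V}, [/\ injective s, forall x, s (f x) = f' x &
    forall i (v : {ffun 'I_(d i) -> V}), m [ffun a => s (v a)] = m v].
Proof.
move=> finj f'inj mff'.
pose th (u : subspace (range_pred f)) := to_range f' (of_range u).
have th_lin : linear th.
  move=> a x y; apply: val_inj; rewrite (linearP (Defs.incl (range_pred f'))) /=.
  rewrite -linearP; congr (f' _); apply: finj.
  by rewrite linearP !of_rangeK linearP.
have th_incl u : Defs.incl _ (th u) = f' (of_range u) by [].
pose h := linear_of th_lin.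
have h_iso : isomorphism (pullback (Defs.incl (range_pred f)) w)
    (pullback (Defs.incl (range_pred f')) w) h.
  split; first split.
  - move=> x y /(congr1 (Defs.incl _)); rewrite !th_incl => /f'inj E.
    by apply: val_inj; rewrite -![val _]of_rangeK E.
  - move=> i g; case: (m_encodes i) => hm enc _.
    rewrite /pullback /= -!enc /= !tlift_tmap //; last exact: multilinear_comp.
    congr (tlift _ _); apply/funext => v; have := mff' i [ffun a => of_range (v a)].
    move=> E; transitivity (m [ffun a => f' ([ffun a => of_range (v a)] a)]).
      by congr m; apply/ffunP => a; rewrite !ffunE.
    by rewrite -E; congr m; apply/ffunP => a; rewrite !ffunE of_rangeK.
  - exists (fun u => to_range f (of_range u)) => u; apply: val_inj.
      rewrite /= -[RHS](of_rangeK u); congr (f _); apply: f'inj.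
      by rewrite of_rangeK.
    rewrite /= -[RHS](of_rangeK u); congr (f' _); apply: finj.
    by rewrite of_rangeK.
have [s [[[sinj sw] _] sh]] := V_homogeneous (finite_dim_range f) (finite_dim_range f') h_iso.
exists s; split=> // [x|i v].
  have := sh (to_range f x); rewrite th_incl /= => ->; congr (f' _); apply: finj.
  by rewrite of_rangeK.
have enc := encodes_pullback (w' := pullback s w i) (m_encodes i) (fun f => erefl).
exact: (encodes_unique char0 (T_standard i) enc (m_encodes i) (sw i)).
Qed.

(** The vanishing clause of [encodes] for [gram_form g]: it singles out the arrays that encode a
    form on the space of row vectors. *)
Definition admissible p i (g : {ffun 'I_(d i) -> 'I_p} -> k) : Prop :=
  forall (nu : int_partition (d i)) (T' : tableau (d i)) (f : schur nu 'rV[k]_p),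
    is_standard nu T' -> T' != T i ->
    tlift (gram_form g) (f (specht_polytabloid k nu T')) = 0.

Lemma gram_admissible p i (b : 'I_p -> V) :
  admissible (fun J : {ffun 'I_(d i) -> 'I_p} => m [ffun a => b (J a)]).
Proof.
move=> nu T' f st ne; case: (m_encodes i) => hm _ kill.
rewrite -(kill nu T' (schur_map (lin_comb b) f) st ne) /= tlift_tmap //.
by congr (tlift _ _); apply/funext => v; rewrite multilinear_lin_comb.
Qed.

(** Universality embeds the row space carrying the forms given by [g]. The images of its first [p]
    unit rows have the same form values as [b], so homogeneity moves them onto [b], and the image of
    the last unit row moves along. *)
Lemma extension p (b : 'I_p -> V) (g : forall i, {ffun 'I_(d i) -> 'I_p.+1} -> k) :
  injective (lin_comb b) -> (forall i, admissible (g i)) ->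
  (forall i (J : {ffun 'I_(d i) -> 'I_p}),
     g i [ffun a => widen_ord (leqnSn p) (J a)] = m [ffun a => b (J a)]) ->
  exists b' : 'I_p.+1 -> V, [/\ injective (lin_comb b'),
    forall l, b' (widen_ord (leqnSn p) l) = b l &
    forall i (J : {ffun 'I_(d i) -> 'I_p.+1}), m [ffun a => b' (J a)] = g i J].
Proof.
move=> binj adm gb; pose E := 'rV[k]_p.+1.
have e_lin i : linear (fun f : schur (lam i) E =>
    tlift (gram_form (g i)) (f (specht_polytabloid k (lam i) (T i))) : k^o).
  move=> a x y; rewrite -(tlift_linear (gram_form_multilinear (g i))).
  by [].
pose e : forms lam E := fun i => linear_of (e_lin i).
have e_encodes i : encodes (T i) (e i) (gram_form (g i)).
  by split=> //; [exact: gram_form_multilinear | move=> *; apply: adm].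
have [h [hinj he]] := V_universal e.
have mh i (x : {ffun 'I_(d i) -> E}) : m [ffun a => h (x a)] = gram_form (g i) x.
  have enc := encodes_pullback (w' := pullback h w i) (m_encodes i) (fun f => erefl).
  exact: (encodes_unique char0 (T_standard i) enc (e_encodes i) (he i)).
pose wid l := unit_row k (widen_ord (leqnSn p) l).
have widinj : injective (lin_comb wid).
  move=> x y E0; apply/rowP => l.
  have coordE z : lin_comb wid z 0 (widen_ord (leqnSn p) l) = z 0 l.
    rewrite summxE (bigD1 l) //= big1 ?addr0 => [|j jl]; rewrite !mxE eqxx /=.
      by rewrite eqxx mulr1.
    by rewrite -val_eqE /= val_eqE eq_sym (negbTE jl) mulr0.
  by rewrite -!coordE E0.
pose f := linear_of (fun a x y => etrans (congr1 h (linearP (lin_comb wid) a x y)) (linearP h a _ _)).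
have fE x : f x = h (lin_comb wid x) by [].
have [||s [sinj sf sm]] := @extend_isometry p f (lin_comb b) _ binj.
- by move=> x y; rewrite !fE => /hinj /widinj.
- move=> i x.
  have ext := multilinear_rV_ext (multilinear_comp f (@m_multilinear i))
     (multilinear_comp (lin_comb b) (@m_multilinear i)).
  apply: ext => J.
  transitivity (g i [ffun a => widen_ord (leqnSn p) (J a)]).
    rewrite -gram_form_unit_row -mh; congr m; apply/ffunP => a; rewrite !ffunE fE.
    by rewrite lin_comb_unit_row.
  by rewrite gb; congr m; apply/ffunP => a; rewrite !ffunE /= lin_comb_unit_row.
exists (fun l => s (h (unit_row k l))); split.
- move=> x y; suff H z : lin_comb (fun l => s (h (unit_row k l))) z = s (h z).
    by rewrite !H => /sinj /hinj.
  rewrite [in RHS](row_unit_rows z) !linear_sum; apply: eq_bigr => l _.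
  by rewrite !linearZ.
- move=> l; rewrite -[RHS](lin_comb_unit_row b l) -sf fE; congr (s (h _)).
  by rewrite lin_comb_unit_row.
- move=> i J; rewrite -gram_form_unit_row -mh -[RHS]sm; congr m.
  by apply/ffunP => a; rewrite !ffunE.
Qed.
End Extension.

(** * Definable relations *)

Section Names.
Variables (r : nat) (d : 'I_r -> nat).

(* Scalar unknowns: a scalar variable, the coordinate of a vector variable with
   respect to a basis vector, and the value of a form on a tuple of basis vectors. *)
Definition name : Type := (nat + nat * nat + {i : 'I_r & {ffun 'I_(d i) -> nat}})%type.
HB.instance Definition _ := Countable.on name.

Definition scalar_name (x : nat) : name := inl (inl x).
Definition coord_name (j l : nat) : name := inl (inr (j, l)).
Definition gram_name i p (J : {ffun 'I_(d i) -> 'I_p}) : name :=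
  inr (Tagged (fun i => {ffun 'I_(d i) -> nat}) [ffun a => nat_of_ord (J a)]).
End Names.

Section Definability.
Variables (k : fieldType) (r : nat) (d : 'I_r -> nat) (V : lmodType k).
Variable m : forall i : 'I_r, {ffun 'I_(d i) -> V} -> k^o.
Variable nm : name d -> nat.
Hypothesis nm_inj : injective nm.
Local Notation valuation := (name d -> k).
Implicit Types (F : valuation) (R : valuation -> (nat -> V) -> Prop).

(** Definability is stated for valuations of names, read through [nm], so that later arguments can
    ignore the numbering of scalar variables. *)
Definition scalar_definable (f : valuation -> (nat -> V) -> k) : Prop :=
  exists t, forall es ev, seval m es ev t = f (es \o nm) ev.

Definition vector_definable (f : valuation -> (nat -> V) -> V) : Prop :=
  exists t, forall es ev, veval m es ev t = f (es \o nm) ev.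

Definition definable R : Prop := exists q, vector_quantifier_free q /\
  forall es ev, holds m es ev q <-> R (es \o nm) ev.

Lemma scalar_definable_ext f g :
  (forall F ev, f F ev = g F ev) -> scalar_definable f -> scalar_definable g.
Proof. by move=> fg [t ht]; exists t => es ev; rewrite ht. Qed.

Lemma scalar_definable_name z : scalar_definable (fun F _ => F z).
Proof. by exists (SVar _ _ (nm z)). Qed.

Lemma scalar_definable_const c : scalar_definable (fun _ _ => c).
Proof. by exists (SConst _ c). Qed.

Lemma scalar_definable_add f g : scalar_definable f -> scalar_definable g ->
  scalar_definable (fun F ev => f F ev + g F ev).
Proof. by move=> [t ht] [u hu]; exists (SAdd t u) => es ev; rewrite /= ht hu. Qed.

Lemma scalar_definable_mul f g : scalar_definable f -> scalar_definable g ->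
  scalar_definable (fun F ev => f F ev * g F ev).
Proof. by move=> [t ht] [u hu]; exists (SMul t u) => es ev; rewrite /= ht hu. Qed.

Lemma scalar_definable_sum I (s : seq I) f : (forall i, scalar_definable (f i)) ->
  scalar_definable (fun F ev => \sum_(i <- s) f i F ev).
Proof.
move=> hf; elim: s => [|i s IH].
  by apply: scalar_definable_ext (scalar_definable_const 0) => F ev; rewrite big_nil.
apply: scalar_definable_ext (scalar_definable_add (hf i) IH) => F ev.
by rewrite big_cons.
Qed.

Lemma scalar_definable_prod I (s : seq I) f : (forall i, scalar_definable (f i)) ->
  scalar_definable (fun F ev => \prod_(i <- s) f i F ev).
Proof.
move=> hf; elim: s => [|i s IH].
  by apply: scalar_definable_ext (scalar_definable_const 1) => F ev; rewrite big_nil.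
apply: scalar_definable_ext (scalar_definable_mul (hf i) IH) => F ev.
by rewrite big_cons.
Qed.

Lemma vector_definable_var x : vector_definable (fun _ ev => ev x).
Proof. by exists (VVar _ _ x). Qed.

Lemma vector_definable_lin_comb I (s : seq I) f (v : I -> nat) :
  (forall i, scalar_definable (f i)) ->
  vector_definable (fun F ev => \sum_(i <- s) f i F ev *: ev (v i)).
Proof.
move=> hf; elim: s => [|i s [u hu]].
  by exists (VZero _ _) => es ev; rewrite big_nil.
have [t ht] := hf i; exists (VAdd (VScale t (VVar _ _ (v i))) u) => es ev.
by rewrite big_cons /= ht hu.
Qed.

Lemma scalar_definable_form i (x : 'I_(d i) -> nat) :
  scalar_definable (fun _ ev => m [ffun a => ev (x a)]).
Proof.
exists (SForm (fun a => VVar _ _ (x a))) => es ev /=.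
by congr m; apply/ffunP => a; rewrite !ffunE.
Qed.

Lemma definable_ext R R' : (forall F ev, R F ev <-> R' F ev) -> definable R -> definable R'.
Proof.
by move=> h [q [qf hq]]; exists q; split=> // es ev; rewrite hq h.
Qed.

Lemma definable_eqS f g : scalar_definable f -> scalar_definable g ->
  definable (fun F ev => f F ev = g F ev).
Proof.
by move=> [t ht] [u hu]; exists (FEqS t u); split=> // es ev; rewrite /= ht hu.
Qed.

Lemma definable_eqV f g : vector_definable f -> vector_definable g ->
  definable (fun F ev => f F ev = g F ev).
Proof.
by move=> [t ht] [u hu]; exists (FEqV t u); split=> // es ev; rewrite /= ht hu.
Qed.

Lemma definable_true : definable (fun _ _ => True).
Proof. by exists (FEqV (VZero _ _) (VZero _ _)). Qed.

Lemma definable_not R : definable R -> definable (fun F ev => ~ R F ev).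
Proof. by move=> [q [qf hq]]; exists (FNot q); split=> // es ev; rewrite /= hq. Qed.

Lemma definable_and R R' : definable R -> definable R' ->
  definable (fun F ev => R F ev /\ R' F ev).
Proof.
move=> [q [qf hq]] [q' [qf' hq']]; exists (FAnd q q').
by split=> [|es ev]; rewrite /= ?qf // hq hq'.
Qed.

Lemma definable_or R R' : definable R -> definable R' ->
  definable (fun F ev => R F ev \/ R' F ev).
Proof.
move=> [q [qf hq]] [q' [qf' hq']]; exists (FOr q q').
by split=> [|es ev]; rewrite /= ?qf // hq hq'.
Qed.

Lemma definable_imp R R' : definable R -> definable R' ->
  definable (fun F ev => R F ev -> R' F ev).
Proof.
move=> [q [qf hq]] [q' [qf' hq']]; exists (FImp q q').
by split=> [|es ev]; rewrite /= ?qf // hq hq'.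
Qed.

Lemma definable_forall_in (I : eqType) (s : seq I) (R : I -> valuation -> (nat -> V) -> Prop) :
  (forall i, definable (R i)) -> definable (fun F ev => forall i, i \in s -> R i F ev).
Proof.
move=> hR; elim: s => [|i s IH]; first by apply: definable_ext definable_true.
apply: definable_ext (definable_and (hR i) IH) => F ev; split=> [[hi hs] j|h].
  by rewrite inE => /orP[/eqP -> //|/hs].
by split=> [|j js]; apply: h; rewrite inE ?eqxx ?js ?orbT.
Qed.

Lemma definable_forall (I : finType) (R : I -> valuation -> (nat -> V) -> Prop) :
  (forall i, definable (R i)) -> definable (fun F ev => forall i, R i F ev).
Proof.
move=> /(definable_forall_in (enum I)); apply: definable_ext => F ev.
by split=> h i; [apply: h; rewrite mem_enum|].
Qed.

Lemma definable_exists_fin (I : finType) (R : I -> valuation -> (nat -> V) -> Prop) :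
  (forall i, definable (R i)) -> definable (fun F ev => exists i, R i F ev).
Proof.
move=> hR; have := definable_not (definable_forall (fun i => definable_not (hR i))).
apply: definable_ext => F ev; split=> [/existsNP[i /contrapT] | [i hi] /(_ i)] //.
by exists i.
Qed.

Definition set_name F z a : valuation := fun y => if y == z then a else F y.

Lemma assign_name es z a : assign es (nm z) a \o nm = set_name (es \o nm) z a.
Proof.
by apply/funext => y; rewrite /assign /set_name /= (inj_eq nm_inj).
Qed.

Lemma definable_exists_name z R : definable R ->
  definable (fun F ev => exists a, R (set_name F z a) ev).
Proof.
move=> [q [qf hq]]; exists (FExS (nm z) q); split=> // es ev /=.
by split=> [] [a h]; exists a; move: h; rewrite hq assign_name.
Qed.

(** Asserting that some such [F'] exists amounts to a block of existential scalar quantifiers over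
    the names in [L]. *)
Definition agree_off (L : seq (name d)) F F' : Prop := forall z, z \notin L -> F' z = F z.

Lemma definable_exists_names L R : definable R ->
  definable (fun F ev => exists F', agree_off L F F' /\ R F' ev).
Proof.
move=> hR; elim: L => [|z L IH].
  apply: definable_ext hR => F ev; split=> [h|[F' [e]]]; first by exists F.
  by have -> : F' = F by apply/funext => z; apply: e.
apply: definable_ext (definable_exists_name z IH) => F ev; split.
  move=> [a [F' [e h]]]; exists F'; split=> // y; rewrite inE negb_or => /andP[yz yL].
  by rewrite e // /set_name (negbTE yz).
move=> [F' [e h]]; exists (F' z), F'; split=> // y yL; rewrite /set_name.
by case: eqVneq => [->|yz] //; apply: e; rewrite inE negb_or yz.
Qed.
End Definability.

(** Choose a finite family from [K] whose span has maximal dimension; adjoining another element of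
    [K] cannot enlarge it. *)
Lemma finite_span (k : fieldType) (U : vectType k) (K : U -> Prop) :
  exists s : seq U, (forall c, c \in s -> K c) /\ forall c, K c -> c \in <<s>>%VS.
Proof.
pose P n := `[< exists2 s : seq U, (forall c, c \in s -> K c) & \dim <<s>>%VS = n >].
have exP : exists n, P n by exists 0%N; apply/asboolP; exists [::]; rewrite // span_nil dimv0.
have [|n /asboolP[s hs ds] hmax] := @ex_maxnP P (\dim {:U}) exP.
  by move=> n /asboolP[s _ <-]; apply/dimvS/subvf.
exists s; split=> // c Kc.
have /hmax : P (\dim <<c :: s>>%VS).
  by apply/asboolP; exists (c :: s) => // e; rewrite inE => /orP[/eqP -> //|/hs].
rewrite -ds => le; have sub : (<<s>> <= <<c :: s>>)%VS by rewrite span_cons addvSr.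
have /eqP -> : <<s>>%VS == <<c :: s>>%VS by rewrite eqEdim sub.
by apply: memv_span; rewrite mem_head.
Qed.

Section AdmissibleFinite.
Variables (k : fieldType) (r : nat) (d : 'I_r -> nat) (T : forall i : 'I_r, tableau (d i)).

(** Admissibility is a family of linear equations in [g], indexed by all [f]. Their coefficient
    vectors lie in a finite-dimensional space, so finitely many suffice and the condition becomes a
    formula. *)
Lemma admissible_finite p i : exists s : seq {ffun {ffun 'I_(d i) -> 'I_p} -> k^o},
  forall g : {ffun 'I_(d i) -> 'I_p} -> k,
    admissible T g <-> forall c, c \in s -> \sum_J g J * c J = 0.
Proof.
pose coef (x : tpow (d i) 'rV[k]_p) : {ffun {ffun 'I_(d i) -> 'I_p} -> k^o} :=
  [ffun J : {ffun 'I_(d i) -> 'I_p} => \sum_(q <- generic_quotient.repr x) q.1 * \prod_a q.2 a 0 (J a) : k].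
have coefE g x : tlift (gram_form g) x = \sum_J g J * coef x J.
  rewrite /tlift /teval /gram_form.
  under eq_bigr => q _ do rewrite scaler_sumr.
  rewrite exchange_big; apply: eq_bigr => J _; rewrite ffunE mulr_sumr /=.
  by apply: eq_bigr => q _; rewrite /GRing.scale /= mulrCA.
pose K c := exists (nu : int_partition (d i)) (T' : tableau (d i)) (f : schur nu 'rV[k]_p),
  [/\ is_standard nu T', T' != T i & c = coef (f (specht_polytabloid k nu T'))].
have [s [sK Ks]] := finite_span K; exists s => g; split=> [adm c /sK|h nu T' f st ne].
  by move=> [nu [T' [f [st ne ->]]]]; rewrite -coefE; apply: adm.
rewrite coefE; have /coord_span -> : coef (f (specht_polytabloid k nu T')) \in <<in_tuple s>>%VS.
  by apply: Ks; exists nu, T', f.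
under eq_bigr => J _ do rewrite sum_ffunE mulr_sumr.
rewrite exchange_big big1 //= => l _.
under eq_bigr => J _ do rewrite ffunE mulrCA.
by rewrite -mulr_sumr h ?mulr0 // mem_nth.
Qed.
End AdmissibleFinite.

(** * Reduction to scalar formulas *)

Scheme sterm_mutual_ind := Induction for sterm Sort Prop
  with vterm_mutual_ind := Induction for vterm Sort Prop.

Section Reduction.
Variables (k : fieldType) (r : nat) (d : 'I_r -> nat) (V : lmodType k).
Variable m : forall i : 'I_r, {ffun 'I_(d i) -> V} -> k^o.
Hypothesis m_multilinear : forall i, multilinear (@m i).
Variable nm : name d -> nat.
Hypothesis nm_inj : injective nm.
Local Notation valuation := (name d -> k).
Local Notation scalar_definable := (scalar_definable m nm).
Local Notation definable := (definable m nm).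
Local Notation formula := (formula k d).

Definition gram_values p (b : 'I_p -> V) (F : valuation) : Prop :=
  forall i (J : {ffun 'I_(d i) -> 'I_p}), F (gram_name J) = m [ffun a => b (J a)].

Definition scalar_values (s : seq nat) (es : nat -> k) (F : valuation) : Prop :=
  forall x, x \in s -> es x = F (scalar_name d x).

Definition vector_values p (b : 'I_p -> V) (s : seq nat) (ev : nat -> V) (F : valuation) : Prop :=
  forall j, j \in s -> ev j = \sum_(l < p) F (coord_name d j l) *: b l.

Section Terms.
Variable p : nat.

Definition sterm_reduct (t : sterm k d) (f : valuation -> k) : Prop :=
  forall (b : 'I_p -> V) es ev F, gram_values b F ->
    scalar_values (sterm_free_svars t) es F -> vector_values b (sterm_free_vvars t) ev F ->
    seval m es ev t = f F.

Definition vterm_reduct (t : vterm k d) (f : 'I_p -> valuation -> k) : Prop :=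
  forall (b : 'I_p -> V) es ev F, gram_values b F ->
    scalar_values (vterm_free_svars t) es F -> vector_values b (vterm_free_vvars t) ev F ->
    veval m es ev t = \sum_l f l F *: b l.

Lemma scalar_values_cat s s' es F : scalar_values (s ++ s') es F ->
  scalar_values s es F /\ scalar_values s' es F.
Proof. by move=> h; split=> x hx; apply: h; rewrite mem_cat hx ?orbT. Qed.

Lemma vector_values_cat b s s' ev F : @vector_values p b (s ++ s') ev F ->
  vector_values b s ev F /\ vector_values b s' ev F.
Proof. by move=> h; split=> x hx; apply: h; rewrite mem_cat hx ?orbT. Qed.

Definition has_sterm_reduct t : Prop :=
  exists2 f, scalar_definable (fun F _ => f F) & sterm_reduct t f.
Definition has_vterm_reduct t : Prop :=
  exists2 f, (forall l, scalar_definable (fun F _ => f l F)) & vterm_reduct t f.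

Lemma SForm_reduct i (a : 'I_(d i) -> vterm k d) :
  (forall j, has_vterm_reduct (a j)) -> has_sterm_reduct (SForm a).
Proof.
move=> IH; have /choice [f hf] : forall j, exists f,
    (forall l, scalar_definable (fun F _ => f l F)) /\ vterm_reduct (a j) f.
  by move=> j; have [f f1 f2] := IH j; exists f.
exists (fun F => \sum_(J : {ffun 'I_(d i) -> 'I_p}) F (gram_name J) * \prod_j f j (J j) F).
  apply: scalar_definable_sum => J; apply: scalar_definable_mul.
    exact: scalar_definable_name.
  by apply: scalar_definable_prod => j; apply: (hf j).1.
move=> b es ev F hg hs hv /=.
pose v := [ffun j : 'I_(d i) => \row_l f j l F].
transitivity (m [ffun j => lin_comb b (v j)]).
  congr m; apply/ffunP => j; rewrite !ffunE.
  rewrite ((hf j).2 b es ev F hg) => [||x hx].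
  - by apply: eq_bigr => l _; rewrite mxE.
  - by move=> x hx; apply: hs; apply/flatten_mapP; exists j; rewrite ?mem_enum.
  - by apply: hv; apply/flatten_mapP; exists j; rewrite ?mem_enum.
rewrite (multilinear_lin_comb _ _ (@m_multilinear i)) /gram_form; apply: eq_bigr => J _.
by rewrite hg; congr (_ * _); apply: eq_bigr => j _; rewrite ffunE mxE.
Qed.

Lemma reducts : (forall t, has_sterm_reduct t) /\ (forall t, has_vterm_reduct t).
Proof.
have S0 x : has_sterm_reduct (SVar k d x).
  exists (fun F => F (scalar_name d x)); first exact: scalar_definable_name.
  by move=> b es ev F _ hs _; apply: hs; rewrite mem_head.
have S1 c : has_sterm_reduct (SConst d c).
  by exists (fun=> c); [exact: scalar_definable_const|].
have S2 t : has_sterm_reduct t -> forall u, has_sterm_reduct u -> has_sterm_reduct (SAdd t u).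
  move=> [f df hf] u [g dg hg]; exists (fun F => f F + g F); first exact: scalar_definable_add.
  move=> b es ev F hb /scalar_values_cat[st su] /vector_values_cat[vt vu] /=.
  by rewrite (hf b es ev F) // (hg b es ev F).
have S3 t : has_sterm_reduct t -> forall u, has_sterm_reduct u -> has_sterm_reduct (SMul t u).
  move=> [f df hf] u [g dg hg]; exists (fun F => f F * g F); first exact: scalar_definable_mul.
  move=> b es ev F hb /scalar_values_cat[st su] /vector_values_cat[vt vu] /=.
  by rewrite (hf b es ev F) // (hg b es ev F).
have V0 x : has_vterm_reduct (VVar k d x).
  exists (fun l F => F (coord_name d x l)); first by move=> l; exact: scalar_definable_name.
  by move=> b es ev F _ _ hv; apply: hv; rewrite mem_head.
have V1 : has_vterm_reduct (VZero k d).
  exists (fun _ _ => 0); first by move=> _; exact: scalar_definable_const.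
  by move=> b es ev F _ _ _; rewrite big1 // => l _; rewrite scale0r.
have V2 t : has_vterm_reduct t -> forall u, has_vterm_reduct u -> has_vterm_reduct (VAdd t u).
  move=> [f df hf] u [g dg hg]; exists (fun l F => f l F + g l F).
    by move=> l; apply: scalar_definable_add.
  move=> b es ev F hb /scalar_values_cat[st su] /vector_values_cat[vt vu] /=.
  rewrite (hf b es ev F) // (hg b es ev F) // -big_split; apply: eq_bigr => l _.
  by rewrite scalerDl.
have V3 t : has_sterm_reduct t -> forall u, has_vterm_reduct u -> has_vterm_reduct (VScale t u).
  move=> [f df hf] u [g dg hg]; exists (fun l F => f F * g l F).
    by move=> l; apply: scalar_definable_mul.
  move=> b es ev F hb /scalar_values_cat[st su] /vector_values_cat[vt vu] /=.
  rewrite (hf b es ev F) // (hg b es ev F) // scaler_sumr; apply: eq_bigr => l _.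
  by rewrite scalerA.
split=> t.
  exact: (sterm_mutual_ind S0 S1 S2 S3 SForm_reduct V0 V1 V2 V3).
exact: (vterm_mutual_ind S0 S1 S2 S3 SForm_reduct V0 V1 V2 V3).
Qed.
End Terms.

(** The predicate [P] precedes the family [b]: truth depends only on coordinates and form values. It
    may depend on [p], since a quantified vector outside the span leads from [p] to [p + 1] basis
    vectors. *)
Definition formula_reduct p (q : formula) (P : valuation -> Prop) : Prop :=
  forall (b : 'I_p -> V) es ev F, injective (lin_comb b) -> gram_values b F ->
    scalar_values (free_svars q) es F -> vector_values b (free_vvars q) ev F ->
    holds m es ev q <-> P F.

Definition reducible (q : formula) : Prop :=
  forall p, exists2 P, definable (fun F _ => P F) & formula_reduct p q P.

Lemma reducible_not q : reducible q -> reducible (FNot q).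
Proof.
move=> h p; have [P dP hP] := h p; exists (fun F => ~ P F); first exact: definable_not.
by move=> b es ev F bi hg hs hv /=; have E := hP b es ev F bi hg hs hv; tauto.
Qed.

Lemma reducible_eqS t u : reducible (FEqS t u).
Proof.
move=> p; have [f df hf] := (reducts p).1 t; have [g dg hg] := (reducts p).1 u.
exists (fun F => f F = g F); first exact: definable_eqS.
move=> b es ev F bi hb /scalar_values_cat[st su] /vector_values_cat[vt vu] /=.
by rewrite (hf b es ev F) // (hg b es ev F).
Qed.

Lemma reducible_eqV t u : reducible (FEqV t u).
Proof.
move=> p; have [f df hf] := (reducts p).2 t; have [g dg hg] := (reducts p).2 u.
exists (fun F => forall l, f l F = g l F).
  by apply: definable_forall => l; apply: definable_eqS.
move=> b es ev F bi hb /scalar_values_cat[st su] /vector_values_cat[vt vu] /=.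
rewrite (hf b es ev F) // (hg b es ev F) //; split=> [E l|E]; last first.
  by apply: eq_bigr => l _; rewrite E.
have /bi /rowP/(_ l) : lin_comb b (\row_l f l F) = lin_comb b (\row_l g l F).
  rewrite /lin_comb; under eq_bigr do rewrite mxE; rewrite E.
  by apply: eq_bigr => j _; rewrite mxE.
by rewrite !mxE.
Qed.

Lemma reducible_binary (conn : Prop -> Prop -> Prop) (op : formula -> formula -> formula) :
  (forall A A' B B', (A <-> A') -> (B <-> B') -> (conn A B <-> conn A' B')) ->
  (forall R R', definable R -> definable R' -> definable (fun F ev => conn (R F ev) (R' F ev))) ->
  (forall q q' es ev, holds m es ev (op q q') <-> conn (holds m es ev q) (holds m es ev q')) ->
  (forall q q', free_svars (op q q') = free_svars q ++ free_svars q') ->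
  (forall q q', free_vvars (op q q') = free_vvars q ++ free_vvars q') ->
  forall q q', reducible q -> reducible q' -> reducible (op q q').
Proof.
move=> ext dconn hop fs fv q q' h h' p; have [P dP hP] := h p; have [P' dP' hP'] := h' p.
exists (fun F => conn (P F) (P' F)); first exact: dconn.
move=> b es ev F bi hb; rewrite fs fv => /scalar_values_cat[st su] /vector_values_cat[vt vu].
by apply: iff_trans (hop _ _ _ _) _; apply: ext; [apply: (hP b) | apply: (hP' b)].
Qed.

Lemma reducible_exS x q : reducible q -> reducible (FExS x q).
Proof.
move=> h p; have [P dP hP] := h p.
exists (fun F => exists a, P (set_name F (scalar_name d x) a)).
  exact: (definable_exists_name nm_inj _ dP).
move=> b es ev F bi hb hs hv /=.
have E a : holds m (assign es x a) ev q <-> P (set_name F (scalar_name d x) a).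
  apply: (hP b) => // y hy; rewrite /assign /set_name; case: eqVneq => [->|yx].
    by rewrite eqxx.
  rewrite (_ : (_ == _) = false); last by apply/eqP => -[/eqP]; rewrite (negbTE yx).
  by apply: hs; rewrite /= mem_filter yx.
by split=> -[a ha]; exists a; apply/E.
Qed.

Lemma reducible_iff q q' : free_svars q = free_svars q' -> free_vvars q = free_vvars q' ->
  (forall es ev, holds m es ev q <-> holds m es ev q') -> reducible q -> reducible q'.
Proof.
move=> fs fv E h p; have [P dP hP] := h p; exists P => // b es ev F bi hb hs hv.
by apply: iff_trans (iff_sym (E es ev)) _; apply: (hP b) => //; rewrite ?fs ?fv.
Qed.
End Reduction.

(** * Finite independent families *)

Definition snoc (A : Type) p (b : 'I_p -> A) (x : A) (l : 'I_p.+1) : A :=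
  oapp b x (insub (val l)).

Lemma snoc_widen A p (b : 'I_p -> A) x l : snoc b x (widen_ord (leqnSn p) l) = b l.
Proof. by rewrite /snoc /= valK. Qed.

Lemma snoc_max A p (b : 'I_p -> A) x : snoc b x ord_max = x.
Proof. by rewrite /snoc insubF //= ltnn. Qed.

(** Names carry indices as natural numbers; extension by zero lets such indices be evaluated. *)
Definition nat_ext (k : fieldType) (V : lmodType k) p (b : 'I_p -> V) (l : nat) : V :=
  oapp b 0 (insub l).

Lemma nat_extE (k : fieldType) (V : lmodType k) p (b : 'I_p -> V) (l : 'I_p) :
  nat_ext b l = b l.
Proof. by rewrite /nat_ext valK. Qed.

Section Independence.
Variables (k : fieldType) (V : lmodType k).

Lemma lin_comb_recr p (b : 'I_p.+1 -> V) (c : 'rV[k]_p.+1) :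
  lin_comb b c = lin_comb (fun l => b (widen_ord (leqnSn p) l))
      (\row_l c 0 (widen_ord (leqnSn p) l)) + c 0 ord_max *: b ord_max.
Proof.
rewrite /lin_comb big_ord_recr /=; congr (_ + _).
by apply: eq_bigr => l _; rewrite mxE.
Qed.

Lemma injective_snoc p (b : 'I_p -> V) v : injective (lin_comb b) ->
  ~ (exists c, v = lin_comb b c) -> injective (lin_comb (snoc b v)).
Proof.
move=> bi nv; apply: raddf_inj => c /=; rewrite lin_comb_recr snoc_max.
have -> : (fun l => snoc b v (widen_ord (leqnSn p) l)) = b.
  by apply/funext => l; rewrite snoc_widen.
set c' := \row_l _; case: (eqVneq (c 0 ord_max) 0) => [c0|c0 E].
  rewrite c0 scale0r addr0 -(linear0 (lin_comb b)) => /bi c'0.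
  apply/rowP => l; rewrite mxE; case: (unliftP ord_max l) => [l' ->|-> //].
  have := congr1 (fun z : 'rV[k]_p => z 0 l') c'0; rewrite !mxE.
  by congr (c 0 _ = 0); apply: val_inj; rewrite /= /bump leqNgt ltn_ord.
case: nv; exists (- (c 0 ord_max)^-1 *: c'); rewrite linearZ /=.
move/eqP: E; rewrite addrC addr_eq0 => /eqP E.
by rewrite scaleNr -scalerN -E scalerK.
Qed.

(** A largest independent subfamily spans. It is recorded by an ordinal and a finite function so
    that all possible choices form a finite disjunction. *)
Lemma exists_basis (s : seq nat) (ev : nat -> V) :
  exists (n : 'I_(size s).+1) (beta : {ffun 'I_n -> 'I_(size s)}),
    injective (lin_comb (fun l => ev (nth 0 s (beta l)))) /\
    forall j, j \in s -> exists c, ev j = lin_comb (fun l => ev (nth 0 s (beta l))) c.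
Proof.
pose P n := `[< exists beta : {ffun 'I_n -> 'I_(size s)},
  injective (lin_comb (fun l => ev (nth 0 s (beta l)))) >].
have exP : exists n, P n.
  exists 0%N; apply/asboolP.
  have f0 : 'I_0 -> 'I_(size s) by case.
  by exists (finfun f0) => x y _; rewrite [x]thinmx0 [y]thinmx0.
have bound n : P n -> (n <= size s)%N.
  move=> /asboolP[beta bi]; rewrite -[n]card_ord -[X in (_ <= X)%N]card_ord.
  apply: (leq_card beta) => l l' E.
  have /bi : lin_comb (fun l => ev (nth 0 s (beta l))) (unit_row k l)
     = lin_comb (fun l => ev (nth 0 s (beta l))) (unit_row k l').
    by rewrite !lin_comb_unit_row E.
  move=> /rowP/(_ l'); rewrite !mxE !eqxx /=; case: eqVneq => [->//|_] /eqP.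
  by rewrite eq_sym oner_eq0.
have [n Pn nmax] := ex_maxnP exP bound; have lt := bound n Pn.
move/asboolP: Pn => [beta bi]; exists (Ordinal (lt : (n < (size s).+1)%N)), beta.
split=> // j js; apply: contrapT => nj.
have js' : (index j s < size s)%N by rewrite index_mem.
have /nmax : P n.+1; last by rewrite ltnn.
apply/asboolP; exists (finfun (snoc beta (Ordinal js'))).
have := injective_snoc bi nj.
congr (injective (lin_comb _)); apply/funext => l; rewrite ffunE /snoc.
by case: insub => //=; rewrite nth_index.
Qed.
End Independence.

(** * Elimination of a vector quantifier *)

Section Elimination.
Variables (k : fieldType) (r : nat) (d : 'I_r -> nat).
Variables (lam : forall i : 'I_r, int_partition (d i)) (V : lmodType k).
Variables (w : forms lam V) (T : forall i : 'I_r, tableau (d i)).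
Variable m : forall i : 'I_r, {ffun 'I_(d i) -> V} -> k^o.
Hypothesis char0 : [pchar k] =i pred0.
Hypothesis T_standard : forall i, is_standard (lam i) (T i).
Hypothesis m_encodes : forall i, encodes (T i) (w i) (@m i).
Hypothesis V_universal : universal w.
Hypothesis V_homogeneous : homogeneous w.
Local Notation valuation := (name d -> k).
Local Notation formula := (formula k d).

Section VectorQuantifier.
Variable nm : name d -> nat.
Hypothesis nm_inj : injective nm.
Local Notation definable := (definable m nm).
Local Notation reducible := (reducible m nm).

Section NewVector.
Variables (p x : nat) (vars : seq nat).

Definition is_new_gram (z : name d) : bool :=
  match z with
  | inr (existT i J) => [exists a, J a == p]
  | _ => false
  end.

(** The names that may change when a vector of index [p] is adjoined as the value of [x]: all
    coordinates of [x], the last coordinate of each variable, and the form values involving index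
    [p]. *)
Definition new_names : seq (name d) :=
  [seq coord_name d x l | l <- iota 0 p.+1] ++ [seq coord_name d j p | j <- vars] ++
  [seq z <- [seq gram_name J | i <- enum 'I_r, J <- enum {ffun 'I_(d i) -> 'I_p.+1}]
     | is_new_gram z].

Lemma coord_new_names j l :
  (coord_name d j l \in new_names) = (j == x) && (l <= p)%N || (l == p) && (j \in vars).
Proof.
rewrite !mem_cat mem_filter (_ : is_new_gram _ = false) // andFb orbF; congr (_ || _).
  apply/mapP/andP => [[l' + [-> ->]]|[/eqP -> h]]; first by rewrite mem_iota /= add0n ltnS eqxx.
  by exists l; rewrite // mem_iota add0n ltnS.
apply/mapP/andP => [[j' h [-> ->]]|[/eqP -> h]]; first by rewrite eqxx.
by exists j.
Qed.

Lemma scalar_new_names y : scalar_name d y \notin new_names.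
Proof.
rewrite !mem_cat mem_filter (_ : is_new_gram _ = false) // andFb orbF.
by apply/norP; split; apply/mapP => -[].
Qed.

Lemma gram_new_names i (J : {ffun 'I_(d i) -> 'I_p.+1}) :
  (gram_name J \in new_names) = [exists a, val (J a) == p].
Proof.
rewrite !mem_cat mem_filter.
have -> : (gram_name J \in [seq coord_name d x l | l <- iota 0 p.+1]) = false.
  by apply: negbTE; apply/mapP => -[].
have -> : (gram_name J \in [seq coord_name d j p | j <- vars]) = false.
  by apply: negbTE; apply/mapP => -[].
rewrite /= [X in _ && X](_ : _ = true) ?andbT.
  by apply: eq_existsb => a; rewrite ffunE.
by apply/allpairsPdep; exists i, J; rewrite !mem_enum.
Qed.

(** Since names store plain natural numbers, the old form values keep their names when the family
    grows. *)
Lemma gram_name_widen i (J : {ffun 'I_(d i) -> 'I_p}) :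
  gram_name [ffun a => widen_ord (leqnSn p) (J a)] = gram_name J.
Proof. by congr (inr (Tagged _ _)); apply/ffunP => a; rewrite !ffunE. Qed.

Lemma gram_old_names i (J : {ffun 'I_(d i) -> 'I_p}) : gram_name J \notin new_names.
Proof.
rewrite -gram_name_widen gram_new_names; apply/existsP => -[a].
by rewrite ffunE /= ltn_eqF.
Qed.

(** The case in which [x] is itself the new basis vector, so that the other variables have last
    coordinate zero. *)
Definition new_frame (F : valuation) : Prop :=
  [/\ forall l : 'I_p.+1, F (coord_name d x l) = (val l == p)%:R,
      forall j, j \in vars -> j != x -> F (coord_name d j p) = 0
    & forall i, admissible T (fun J : {ffun 'I_(d i) -> 'I_p.+1} => F (gram_name J))].

Lemma definable_new_frame : definable (fun F _ => new_frame F).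
Proof.
pose C i := sval (cid (admissible_finite k T p.+1 i)).
have hC i := svalP (cid (admissible_finite k T p.+1 i)).
refine (@definable_ext k r d V m nm (fun F _ =>
  (forall l : 'I_p.+1, F (coord_name d x l) = (val l == p)%:R) /\
  ((forall j, j \in vars -> j != x -> F (coord_name d j p) = 0) /\
   forall i c, c \in C i -> \sum_J F (gram_name J) * c J = 0)) _ _ _).
  move=> F _; split=> [[h1 [h2 h3]]|[h1 h2 h3]].
    by split=> // i; apply/hC; apply: h3.
  by split=> //; split=> // i; apply/hC; apply: h3.
apply: definable_and; last apply: definable_and.
- apply: definable_forall => l; apply: definable_eqS; first exact: scalar_definable_name.
  exact: scalar_definable_const.
- apply: definable_forall_in => j; case: (j != x).
    apply: (definable_ext (R := fun F _ => F (coord_name d j p) = 0)).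
      by move=> F _; split=> // /(_ isT).
    apply: definable_eqS; first exact: scalar_definable_name.
    exact: scalar_definable_const.
  by apply: (definable_ext (R := fun _ _ => True)); last exact: definable_true.
- apply: definable_forall => i; apply: definable_forall_in => c.
  apply: definable_eqS; last exact: scalar_definable_const.
  apply: scalar_definable_sum => J; apply: scalar_definable_mul.
    exact: scalar_definable_name.
  exact: scalar_definable_const.
Qed.

Lemma new_vector_values (b : 'I_p -> V) (b' : 'I_p.+1 -> V) ev F F' :
  agree_off new_names F F' -> new_frame F' ->
  (forall l, b' (widen_ord (leqnSn p) l) = b l) ->
  vector_values b [seq y <- vars | y != x] ev F ->
  vector_values b' vars (assign ev x (b' ord_max)) F'.
Proof.
move=> off [fx f0 _] bb hv j hj; rewrite big_ord_recr /= /assign.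
case: (eqVneq j x) => [->|jx].
  rewrite big1 => [|l _]; last first.
    by have /= -> := fx (widen_ord (leqnSn p) l); rewrite ltn_eqF // scale0r.
  by have /= -> := fx ord_max; rewrite add0r eqxx scale1r.
rewrite (f0 j) // scale0r addr0 hv ?mem_filter ?jx //; apply: eq_bigr => l _.
by rewrite bb off // coord_new_names (negbTE jx) /= ltn_eqF.
Qed.
End NewVector.

(** Two cases: a witness in the span of [b] amounts to [p] scalars, and a witness outside it amounts
    to an admissible array extending the old form values. *)
Lemma reducible_exV x q : reducible q -> reducible (FExV x q).
Proof.
move=> h p; have [P0 dP0 hP0] := h p; have [P1 dP1 hP1] := h p.+1.
pose vars := free_vvars q; pose old := [seq coord_name d x l | l <- iota 0 p].
exists (fun F => (exists F', agree_off old F F' /\ P0 F') \/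
  exists F', agree_off (new_names p x vars) F F' /\ (new_frame p x vars F' /\ P1 F')).
  apply: definable_or; apply: definable_exists_names => //.
  by apply: definable_and dP1; exact: definable_new_frame.
move=> b es ev F bi hg hs hv /=; split=> [[v hq]|[[F' [off hP]]|[F' [off [fr hP]]]]].
- case: (pselect (exists c, v = lin_comb b c)) => [[c vE]|nv].
    left; pose F' z := if z \in old then
      if z is inl (inr (_, l)) then oapp (c 0) 0 (insub l) else 0 else F z.
    have off : agree_off old F F' by move=> z; rewrite /F' => /negbTE ->.
    have gr i (J : {ffun 'I_(d i) -> 'I_p}) : gram_name J \notin old by apply/mapP => -[].
    have sc y : scalar_name d y \notin old by apply/mapP => -[].
    exists F'; split=> //; apply/(hP0 b es (assign ev x v)) => // [i J|y hy|j hj].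
    + by rewrite off ?gr.
    + by rewrite off ?sc //; apply: hs.
    + rewrite /assign; case: (eqVneq j x) => [->|jx].
        rewrite vE; apply: eq_bigr => l _; rewrite /F' map_f ?mem_iota ?add0n //=.
        by rewrite valK.
      rewrite hv ?mem_filter ?jx //; apply: eq_bigr => l _; rewrite off //.
      by apply/mapP => -[l' _ [E]]; rewrite E eqxx in jx.
  right; pose b' := snoc b v; pose N := new_names p x vars.
  (* Changed names receive their true values for [b']; the coordinates of [x] become those of the
     last unit vector. *)
  pose F2 (z : name d) : k := match z with
    | inl (inl _) => 0
    | inl (inr (j, l)) => ((j == x) && (l == p))%:R
    | inr (existT i J) => m [ffun a => nat_ext b' (J a)] : k
    end.
  pose F' z := if z \in N then F2 z else F z.
  have off : agree_off N F F' by move=> z; rewrite /F' => /negbTE ->.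
  have gF' : gram_values m b' F'.
    move=> i J; rewrite /F' gram_new_names; case: existsP => [[a Ja]|no].
      by congr m; apply/ffunP => a'; rewrite !ffunE nat_extE.
    have lt a : (J a < p)%N.
      rewrite ltn_neqAle -ltnS ltn_ord andbT; apply/negP => Ja; apply: no.
      by exists a.
    have [J' JE] : exists J' : {ffun 'I_(d i) -> 'I_p},
        J = [ffun a => widen_ord (leqnSn p) (J' a)].
      exists [ffun a => Ordinal (lt a)].
      by apply/ffunP => a; rewrite !ffunE; apply: val_inj.
    rewrite JE gram_name_widen hg; congr m; apply/ffunP => a.
    by rewrite !ffunE /b' snoc_widen.
  have fr : new_frame p x vars F'.
    split=> [l|j hj jx|i].
    + by rewrite /F' coord_new_names eqxx -ltnS ltn_ord /= eqxx.
    + by rewrite /F' coord_new_names eqxx hj orbT /= (negbTE jx).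
    + have := @gram_admissible _ _ _ _ _ _ _ _ m_encodes p.+1 i b'.
      by congr (admissible T _); apply/funext => J; rewrite gF'.
  exists F'; split=> //; split=> //.
  have vmax : v = b' ord_max by rewrite /b' snoc_max.
  apply/(hP1 b' es (assign ev x v)) => //.
  + exact: injective_snoc.
  + by move=> y hy; rewrite off ?hs // scalar_new_names.
  + rewrite vmax; apply: (new_vector_values off fr) hv => l.
    by rewrite /b' snoc_widen.
- pose c := \row_l F' (coord_name d x l) : 'rV[k]_p.
  exists (lin_comb b c); apply/(hP0 b _ _ F') => // [i J|y hy|j hj].
  + by rewrite off ?hg //; apply/mapP => -[].
  + by rewrite off ?hs //; apply/mapP => -[].
  + rewrite /assign; case: (eqVneq j x) => [->|jx].
      by apply: eq_bigr => l _; rewrite mxE.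
    rewrite hv ?mem_filter ?jx //; apply: eq_bigr => l _; rewrite off //.
    by apply/mapP => -[l' _ [E]]; rewrite E eqxx in jx.
(* Conversely, [extension] realises the quantified array by an actual vector, the last one of
   [b']. *)
- have [_ _ adm] := fr.
  have [|b' [bi' bb gb']] := @extension _ _ _ _ _ _ _ _ char0 T_standard m_encodes V_universal
      V_homogeneous p b (fun i J => F' (gram_name J)) bi adm.
    by move=> i J; rewrite gram_name_widen off ?hg // gram_old_names.
  exists (b' ord_max); apply/(hP1 b' _ _ F') => //.
  + by move=> y hy; rewrite off ?hs // scalar_new_names.
  + exact: (new_vector_values off fr bb hv).
Qed.

Lemma all_reducible q : reducible q.
Proof.
have mm := m_multilinear m_encodes.
have ex2 (x : nat) q' : reducible q' -> reducible (FNot (FExV x (FNot q'))).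
  by move=> h; apply/reducible_not/reducible_exV/reducible_not.
have ex1 (x : nat) q' : reducible q' -> reducible (FNot (FExS x (FNot q'))).
  by move=> h; apply/reducible_not/(reducible_exS nm_inj)/reducible_not.
elim: q => [t u|t u|q|q hq q' hq'|q hq q' hq'|q hq q' hq'|x q hq|x q hq|x q hq|x q hq].
- exact: reducible_eqS.
- exact: reducible_eqV.
- exact: reducible_not.
- apply: (reducible_binary (conn := and)) hq hq' => //; first by move=> *; tauto.
  exact: definable_and.
- apply: (reducible_binary (conn := or)) hq hq' => //; first by move=> *; tauto.
  exact: definable_or.
- apply: (reducible_binary (conn := fun A B => A -> B)) hq hq' => //; first by move=> *; tauto.
  exact: definable_imp.
- apply: reducible_iff (ex1 x q hq) => // es ev /=; split=> [h a|h [a]]; last by apply.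
  by apply: contrapT => ha; apply: h; exists a.
- exact: reducible_exS.
- apply: reducible_iff (ex2 x q hq) => // es ev /=; split=> [h a|h [a]]; last by apply.
  by apply: contrapT => ha; apply: h; exists a.
- exact: reducible_exV.
Qed.
End VectorQuantifier.
End Elimination.

(** * Universal closures and the final choice of a basis *)

Section UniversalClosure.
Variables (k : fieldType) (r : nat) (d : 'I_r -> nat).
Implicit Types (q : formula k d) (s : seq nat).

Lemma free_svars_FAllS q s :
  free_svars (foldr (@FAllS k r d) q s) = [seq y <- free_svars q | y \notin s].
Proof.
elim: s => [|x s IH] /=; first by rewrite filter_predT.
rewrite IH -filter_predI; apply: eq_filter => y.
by rewrite /= inE negb_or.
Qed.

Lemma free_vvars_FAllS q s : free_vvars (foldr (@FAllS k r d) q s) = free_vvars q.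
Proof. by elim: s. Qed.

Lemma free_svars_FAllV q s : free_svars (foldr (@FAllV k r d) q s) = free_svars q.
Proof. by elim: s. Qed.

Lemma free_vvars_FAllV q s :
  free_vvars (foldr (@FAllV k r d) q s) = [seq y <- free_vvars q | y \notin s].
Proof.
elim: s => [|x s IH] /=; first by rewrite filter_predT.
rewrite IH -filter_predI; apply: eq_filter => y.
by rewrite /= inE negb_or.
Qed.

Lemma filter_notin_nil s : [seq y <- s | y \notin s] = [::].
Proof.
by apply/eqP; rewrite -[_ == _]negbK -has_filter; apply/hasP => -[y ->].
Qed.

Lemma sentence_universal_closure q : sentence (universal_closure q).
Proof.
rewrite /sentence /universal_closure free_svars_FAllS free_vvars_FAllS.
by rewrite free_svars_FAllV free_vvars_FAllV !filter_notin_nil.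
Qed.

Variables (V : lmodType k) (m : forall i : 'I_r, {ffun 'I_(d i) -> V} -> k^o).

Lemma universal_closure_in_theory q :
  (forall es ev, holds m es ev q) -> in_theory m (universal_closure q).
Proof.
move=> hq; split; first exact: sentence_universal_closure.
rewrite /universal_closure; elim: (free_svars q) => [|x s IH] es ev /=; last first.
  by move=> a; apply: IH.
by elim: (free_vvars q) es ev => [|x s IH] es ev //= v; apply: IH.
Qed.
End UniversalClosure.

(** The formula to be constructed must share its free scalar variables with the given one, while all
    auxiliary names need variables of their own. *)
Lemma fresh_names (r : nat) (d : 'I_r -> nat) (s : seq nat) :
  exists2 nm : name d -> nat, injective nm &
    forall x, x \in s -> nm (scalar_name d x) = x.
Proof.
(* The given names stay below [M]; all others are coded above it. *)
pose M := (\max_(x <- s) x).+1.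
pose low (z : name d) := if z is inl (inl x) then (x < M)%N else false.
pose nm (z : name d) : nat :=
  if z is inl (inl x) then if (x < M)%N then x else (M + pickle z)%N else (M + pickle z)%N.
have lowE z : low z -> exists2 x, z = scalar_name d x & nm z = x.
  by case: z => [[x|//]|//] /= lt; exists x => //; rewrite lt.
have highE z : ~~ low z -> nm z = (M + pickle z)%N.
  by case: z => [[x|//]|//] /=; case: ifP.
have ltM z : (nm z < M)%N = low z.
  case: (boolP (low z)) => [h|/highE ->]; last by rewrite ltnNge leq_addr.
  by case: z h => [[x|//]|//] /= h; rewrite h.
exists nm => [z z' E|x xs]; last first.
  have lt : (x < M)%N by rewrite ltnS; apply: (@leq_bigmax_seq _ s xpredT id).
  by rewrite /= lt.
have : low z = low z' by rewrite -!ltM E.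
case: (boolP (low z)) => [/lowE [x zx nx] /esym /lowE [x' zx' nx']|hz hz'].
  by rewrite zx zx' -nx E nx'.
move: E; rewrite !highE -?hz' // => /addnI; exact: pcan_inj pickleK z z'.
Qed.

Theorem theorem5p18 (k : fieldType) (char0 : [pchar k] =i pred0)
    (r : nat) (d : 'I_r -> nat) (lam : forall i : 'I_r, int_partition (d i))
    (pure : forall i, lam i <> [::] :> seq nat)
    (V : lmodType k) (w : forms lam V)
    (V_dim : countably_infinite_dim V)
    (V_universal : universal w) (V_homogeneous : homogeneous w)
    (T : forall i : 'I_r, tableau (d i))
    (T_standard : forall i, is_standard (lam i) (T i))
    (m : forall i : 'I_r, {ffun 'I_(d i) -> V} -> k^o)
    (m_encodes : forall i, encodes (T i) (w i) (m i)) :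
  vector_quantifier_elimination m.
Proof.
move=> q; have [nm nm_inj nmE] := fresh_names d (free_svars q).
have /choice [P hP] : forall p, exists P, definable m nm (fun F _ => P F) /\ formula_reduct m p q P.
  move=> p; have [P dP hP] :=
    all_reducible char0 T_standard m_encodes V_universal V_homogeneous nm_inj q p.
  by exists P.
pose s := free_vvars q.
pose vec n (beta : {ffun 'I_n -> 'I_(size s)}) l := nth 0%N s (beta l).
(* The coefficients of a linear relation borrow the coordinate names of the vector variable [0];
   they are bound by a separate block of quantifiers, so no clash with [L] arises. *)
pose coefs n := [seq coord_name d 0 l | l <- iota 0 n].
pose L n := [seq coord_name d j l | j <- s, l <- iota 0 n] ++
  [seq gram_name J | i <- enum 'I_r, J <- enum {ffun 'I_(d i) -> 'I_n}].
pose dependent n beta (F : name d -> k) (ev : nat -> V) := exists F', agree_off (coefs n) F F' /\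
  (\sum_(l <- enum 'I_n) F' (coord_name d 0 l) *: ev (@vec n beta l) = 0 /\
   ~ forall l : 'I_n, F' (coord_name d 0 l) = 0).
pose described n beta (F : name d -> k) (ev : nat -> V) := exists F', agree_off (L n) F F' /\
  ((forall j, j \in s -> ev j = \sum_(l <- enum 'I_n) F' (coord_name d j l) *: ev (@vec n beta l)) /\
   ((forall i (J : {ffun 'I_(d i) -> 'I_n}),
       F' (gram_name J) = m i [ffun a => ev (@vec n beta (J a))]) /\ P n F')).
(* The formula sought: a finite disjunction over choices of an independent subfamily of the free
   vector variables. Each disjunct introduces coordinates and form values by scalar quantifiers and
   then asserts [P n]. *)
pose R F ev := exists (n : 'I_(size s).+1) (beta : {ffun 'I_n -> 'I_(size s)}),
  ~ dependent n beta F ev /\ described n beta F ev.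
have [q' [qf hq']] : definable m nm R.
  apply: definable_exists_fin => n; apply: definable_exists_fin => beta; apply: definable_and.
    apply/definable_not/definable_exists_names => //; apply: definable_and.
      apply: definable_eqV; last by exists (VZero _ _).
      by apply: vector_definable_lin_comb => l; exact: scalar_definable_name.
    apply/definable_not/definable_forall => l; apply: definable_eqS.
      exact: scalar_definable_name.
    exact: scalar_definable_const.
  apply: definable_exists_names => //; apply: definable_and; last apply: definable_and.
  - apply: definable_forall_in => j; apply: definable_eqV; first exact: vector_definable_var.
    by apply: vector_definable_lin_comb => l; exact: scalar_definable_name.
  - apply: definable_forall => i; apply: definable_forall => J; apply: definable_eqS.
      exact: scalar_definable_name.
    have [t ht] := scalar_definable_form m nm (fun a => vec n beta (J a)).
    by exists t => es ev; rewrite ht.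
  - exact: (hP n).1.
exists q'; split=> //; apply: universal_closure_in_theory => es ev.
suff E : holds m es ev q <-> R (es \o nm) ev by split=> /=; move/E/hq' || move/hq'/E.
have scalarL n F' : agree_off (L n) (es \o nm) F' -> scalar_values (free_svars q) es F'.
  move=> off x hx; rewrite off /= ?nmE // mem_cat; apply/norP.
  by split; apply/allpairsPdep => -[? [? []]].
have coord0 n j l : (coord_name d j l \in L n) = (j \in s) && (l < n)%N.
  rewrite mem_cat [X in _ || X](_ : _ = false) ?orbF; last first.
    by apply: negbTE; apply/allpairsPdep => -[? [? []]].
  apply/allpairsPdep/andP => [[j' [l' [hj hl [-> ->]]]]|[hj hl]].
    by rewrite mem_iota in hl.
  by exists j, l; rewrite mem_iota.
split=> [hq|[n [beta [indep [F' [off [hv [hg hPn]]]]]]]].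
  have [n [beta [bi gen]]] := exists_basis s ev.
  pose b l := ev (vec n beta l).
  have /choice [c hc] : forall j, exists c, j \in s -> ev j = lin_comb b c.
    move=> j; case: (boolP (j \in s)) => [/gen [c hc]|_]; last by exists 0.
    by exists c.
  pose F2 (z : name d) : k := match z with
    | inl (inl _) => 0
    | inl (inr (j, l)) => oapp (c j 0) 0 (insub l)
    | inr (existT i J) => m i [ffun a => nat_ext b (J a)]
    end.
  pose F' z := if z \in L n then F2 z else es (nm z).
  have off : agree_off (L n) (es \o nm) F' by move=> z; rewrite /F' => /negbTE ->.
  have hv j : j \in s -> ev j = \sum_(l < n) F' (coord_name d j l) *: b l.
    move=> hj; rewrite (hc j hj); apply: eq_bigr => l _.
    by rewrite /F' coord0 hj ltn_ord /= valK.
  have hg i (J : {ffun 'I_(d i) -> 'I_n}) : F' (gram_name J) = m i [ffun a => b (J a)].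
    rewrite /F' mem_cat [X in _ || X](_ : _ = true) ?orbT; last first.
      by apply/allpairsPdep; exists i, J; rewrite !mem_enum.
    by congr (m i); apply/ffunP => a; rewrite !ffunE nat_extE.
  exists n, beta; split.
    move=> [G [_ [sum0]]]; apply => l.
    have /bi /rowP/(_ l) : lin_comb b (\row_l G (coord_name d 0 l)) = lin_comb b 0.
      rewrite linear0 -[RHS]sum0 big_enum; apply: eq_bigr => l' _.
      by rewrite mxE.
    by rewrite !mxE.
  exists F'; split=> //; split; first by move=> j hj; rewrite big_enum hv.
  split=> //; apply/((hP n).2 b es ev F') => //; exact: scalarL off.
pose b (l : 'I_n) := ev (vec n beta l).
apply/((hP n).2 b es ev F') => //.
(* A nontrivial relation, written into the names [coefs n], would witness [dependent]. *)
- apply: raddf_inj => c /= c0; apply: contrapT => cn; apply: indep.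
  pose F0 z := if z \in coefs n then
    if z is inl (inr (_, l)) then oapp (c 0) 0 (insub l) else 0 else es (nm z).
  have F0E (l : 'I_n) : F0 (coord_name d 0 l) = c 0 l.
    by rewrite /F0 map_f ?mem_iota ?add0n //= valK.
  exists F0; split; first by move=> z; rewrite /F0 => /negbTE ->.
  split; first by rewrite big_enum -[RHS]c0; apply: eq_bigr => l _; rewrite F0E.
  by move=> h; apply: cn; apply/rowP => l; rewrite mxE -F0E h.
- exact: scalarL off.
- by move=> j hj; rewrite hv // big_enum.
Qed.
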